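(* Let $A,B,C,D$ be pointed types. The pentagon identity holds for the smash product, i.e. there is an equality of pointed functions $((A\wedge B)\wedge C)\wedge D\to_\star A\wedge(B\wedge(C\wedge D))$ $$(1_A\wedge\alpha_{B,C,D})\circ\alpha_{A,B\wedge C,D}\circ(\alpha_{A,B,C}\wedge 1_D)=\alpha_{A,B,C\wedge D}\circ\alpha_{A\wedge B,C,D}.$$
   Context: Setting: Homotopy Type Theory (univalence, higher inductive types (HITs)). A pointed function $A\to_\star B$ is a function $f$ with a path $\star_f:f(\star_A)=\star_B$; equality of pointed functions is equality in this $\Sigma$-type. $\mathsf{ap}$ is the action on paths; $\cdot$ is path composition in diagrammatic order. Smash product: for pointed $A,B$, $A\wedge B$ is the HIT generated by a point $\star_\wedge$; points $\langle a,b\rangle$; paths $\mathsf{push_l}(a):\langle a,\star_B\rangle=\star_\wedge$; paths $\mathsf{push_r}(b):\langle\star_A,b\rangle=\star_\wedge$; and a 2-path $\mathsf{push_{lr}}:\mathsf{push_l}(\star_A)=\mathsf{push_r}(\star_B)$; pointed by $\star_\wedge$. For $f:A\to_\star C$, $g:B\to_\star D$, $f\wedge g:A\wedge B\to_\star C\wedge D$ sends $\star_\wedge\mapsto\star_\wedge$, $\langle a,b\rangle\mapsto\langle f(a),g(b)\rangle$, $\mathsf{push_l}(a)\mapsto\mathsf{ap}_{\langle f(a),-\rangle}(\star_g)\cdot\mathsf{push_l}(f(a))$, $\mathsf{push_r}(b)\mapsto\mathsf{ap}_{\langle-,g(b)\rangle}(\star_f)\cdot\mathsf{push_r}(g(b))$,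 $\mathsf{push_{lr}}$ to the evident coherence (path induction on $\star_f,\star_g$ from $\mathsf{push_{lr}}$); pointed by $\mathsf{refl}$. $\beta_{A,B}:A\wedge B\simeq_\star B\wedge A$ is induced by swapping: $\star_\wedge\mapsto\star_\wedge$, $\langle a,b\rangle\mapsto\langle b,a\rangle$, $\mathsf{push_l}(a)\mapsto\mathsf{push_r}(a)$, $\mathsf{push_r}(b)\mapsto\mathsf{push_l}(b)$, $\mathsf{push_{lr}}\mapsto\mathsf{push_{lr}}^{-1}$; pointed by $\mathsf{refl}$. Associator. $\bigwedge(A,B,C)$ is the HIT generated by: a point $\star_{2\wedge}$; points $\langle a,b,c\rangle$; paths $\mathsf{push}_0(b,c):\langle\star_A,b,c\rangle=\star_{2\wedge}$, $\mathsf{push}_1(a,c):\langle a,\star_B,c\rangle=\star_{2\wedge}$, $\mathsf{push}_2(a,b):\langle a,b,\star_C\rangle=\star_{2\wedge}$; 2-paths $\mathsf{push}_{1,2}(a):\mathsf{push}_1(a,\star_C)=\mathsf{push}_2(a,\star_B)$, $\mathsf{push}_{0,2}(b):\mathsf{push}_0(b,\star_C)=\mathsf{push}_2(\star_A,b)$, $\mathsf{push}_{0,1}(c):\mathsf{push}_0(\star_B,c)=\mathsf{push}_1(\star_A,c)$; and a 3-path $\mathsf{push}_{0,1,2}$ filling the triangle $\mathsf{push}_{0,2}(\star_B)=\mathsf{push}_{0,1}(\star_C)\cdot\mathsf{push}_{1,2}(\star_A)$. The equivalence $(A\wedge B)\wedge C\simeq\bigwedge(A,B,C)$ is given on constructors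 (up to orientation and the simple coherences needed for well-typedness in the higher cases) by $\star_\wedge\mapsto\star_{2\wedge}$; $\langle\star_\wedge,c\rangle\mapsto\star_{2\wedge}$; $\langle\langle a,b\rangle,c\rangle\mapsto\langle a,b,c\rangle$; $\mathsf{ap}_{\langle-,c\rangle}(\mathsf{push_l}(a))\mapsto\mathsf{push}_1(a,c)$; $\mathsf{ap}_{\langle-,c\rangle}(\mathsf{push_r}(b))\mapsto\mathsf{push}_0(b,c)$; $\mathsf{ap}_{\mathsf{ap}_{\langle-,c\rangle}}(\mathsf{push_{lr}})\mapsto\mathsf{push}_{0,1}(c)$; $\mathsf{push_l}(\star_\wedge)\mapsto\mathsf{refl}$; $\mathsf{push_l}\langle a,b\rangle\mapsto\mathsf{push}_2(a,b)$; $\mathsf{ap}_{\mathsf{push_l}}(\mathsf{push_l}(a))\mapsto\mathsf{push}_{1,2}(a)$; $\mathsf{ap}_{\mathsf{push_l}}(\mathsf{push_r}(b))\mapsto\mathsf{push}_{0,2}(b)$; $\mathsf{ap}_{\mathsf{ap}_{\mathsf{push_l}}}(\mathsf{push_{lr}})\mapsto\mathsf{push}_{0,1,2}$; $\mathsf{push_r}(c)\mapsto\mathsf{refl}$; $\mathsf{push_{lr}}\mapsto\mathsf{refl}$. Then $\alpha_{A,B,C}:(A\wedge B)\wedge C\simeq_\star A\wedge(B\wedge C)$ is the composite $$(A\wedge B)\wedge C\simeq\bigwedge(A,B,C)\simeq\bigwedge(B,C,A)\simeq(B\wedge C)\wedge A\simeq A\wedge(B\wedge C),$$ where the second equivalence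 is the evident permutation of constructors ($\langle a,b,c\rangle\mapsto\langle b,c,a\rangle$, $\mathsf{push}_0(b,c)\mapsto\mathsf{push}_2(b,c)$, $\mathsf{push}_1(a,c)\mapsto\mathsf{push}_0(c,a)$, $\mathsf{push}_2(a,b)\mapsto\mathsf{push}_1(b,a)$, and correspondingly on higher constructors), the third is the inverse of the equivalence just described (for $B,C,A$), and the last is $\beta_{B\wedge C,A}$; it is pointed by $\mathsf{refl}$. In particular $\alpha_{A,B,C}\langle\langle a,b\rangle,c\rangle=\langle a,\langle b,c\rangle\rangle$. *)

(* Defs.v *)
Set Primitive Projections.

(* Identity types live in [Type] (not in [Prop]), and [=] denotes them from here on. *)
Set Warnings "-notation-overridden".
Inductive paths {A : Type} (x : A) : A -> Type := idpath : paths x x.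
Arguments idpath {A x}, [A] x.
Notation "x = y :> A" := (@paths A x y) : type_scope.
Notation "x = y" := (paths x y) : type_scope.

Declare Scope path_scope.
Delimit Scope path_scope with path.
Open Scope path_scope.

Definition inverse {A : Type} {x y : A} (p : x = y) : y = x :=
  match p with idpath => idpath end.
Definition concat {A : Type} {x y z : A} (p : x = y) : y = z -> x = z :=
  match p with idpath => fun q => q end.
Notation "! p" := (inverse p) (at level 3, right associativity, format "! p") : path_scope.
Notation "p @ q" := (concat p q) (at level 20, left associativity) : path_scope.

Definition ap {A B : Type} (f : A -> B) {x y : A} (p : x = y) : f x = f y :=
  match p with idpath => idpath end.
Definition transport {A : Type} (P : A -> Type) {x y : A} (p : x = y) : P x -> P y :=
  match p with idpath => fun u => u end.
Arguments transport {A} P {x y} p u.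
Definition apd {A : Type} {P : A -> Type} (f : forall x, P x) {x y : A} (p : x = y) :
  transport P p (f x) = f y :=
  match p with idpath => idpath end.

Set Implicit Arguments.
Record sigma {A : Type} (P : A -> Type) := dpair { pr1 : A; pr2 : P pr1 }.
Unset Implicit Arguments.
Arguments dpair {A P} pr1 pr2.

Definition concat_p1 {A : Type} {x y : A} (p : x = y) : p @ idpath = p :=
  match p with idpath => idpath end.
Definition ap_pp {A B : Type} (f : A -> B) {x y z : A} (p : x = y) (q : y = z) :
  ap f (p @ q) = ap f p @ ap f q.
Proof. destruct p. exact idpath. Defined.

Set Implicit Arguments.
Record IsEquiv {A B : Type} (f : A -> B) := {
  equiv_inv : B -> A;
  eisretr : forall b, f (equiv_inv b) = b;
  eissect : forall a, equiv_inv (f a) = a;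
  eisadj : forall a, eisretr (f a) = ap f (eissect a) }.
Unset Implicit Arguments.

Lemma adjointify_adj {A B : Type} (f : A -> B) (g : B -> A)
  (r : forall b, f (g b) = b) (s : forall a, g (f a) = a) (a : A) :
  !(r (f (g (f a)))) @ (ap f (s (g (f a))) @ r (f a)) = ap f (s a).
Proof.
  assert (natr : forall b b' (q : b = b'), ap f (ap g q) @ r b' = r b @ q)
    by (intros b b' []; exact !(concat_p1 _)).
  assert (nats : forall x y (q : x = y), s x @ q = ap g (ap f q) @ s y)
    by (intros x y []; exact (concat_p1 _)).
  assert (cancel : forall x y z (p p' : x = y :> A) (q : y = z), p @ q = p' @ q -> p = p')
    by (intros x y z p p' [] e; exact (!(concat_p1 _) @ (e @ concat_p1 _))).
  pose proof (cancel _ _ _ _ _ _ (nats _ _ (s a))) as e.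
  refine (ap (fun z => _ @ (ap f z @ _)) e @ _).
  refine (ap (fun z => _ @ z) (natr _ _ (ap f (s a))) @ _).
  assert (K : forall x y z (p : x = y :> B) (q : y = z), !p @ (p @ q) = q)
    by (intros x y z [] q; exact idpath).
  apply K.
Qed.

Definition isequiv_adjointify {A B : Type} (f : A -> B) (g : B -> A)
  (r : forall b, f (g b) = b) (s : forall a, g (f a) = a) : IsEquiv f :=
  {| equiv_inv := g;
     eisretr := fun b => !(r (f (g b))) @ (ap f (s (g b)) @ r b);
     eissect := s;
     eisadj := adjointify_adj f g r s |}.

Definition happly {A : Type} {P : A -> Type} {f g : forall x, P x} (p : f = g) (x : A) :
  f x = g x := ap (fun h => h x) p.

(* The only consequence of univalence that is used; it is always passed as an explicit hypothesis. *)
Definition Funext := forall (A : Type) (P : A -> Type) (f g : forall x, P x),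
  IsEquiv (@happly A P f g).

Definition funext (fe : Funext) {A : Type} {P : A -> Type} {f g : forall x, P x} :
  (forall x, f x = g x) -> f = g := equiv_inv (fe A P f g).

Lemma htpy_ind (fe : Funext) {A : Type} {P : A -> Type} (f : forall x, P x)
  (Q : forall g, (forall x, f x = g x) -> Type) (q : Q f (fun x => idpath)) g H : Q g H.
Proof.
  refine (transport (Q g) (eisretr (fe _ _ f g) H) _).
  destruct (equiv_inv (fe A P f g) H). exact q.
Qed.

Lemma htpy_ind_r (fe : Funext) {A : Type} {P : A -> Type} (f : forall x, P x)
  (Q : forall g, (forall x, g x = f x) -> Type) (q : Q f (fun x => idpath)) g H : Q g H.
Proof.
  refine (transport (Q g) (eisretr (fe _ _ g f) H) _).
  generalize (equiv_inv (fe A P g f) H). intro p. clear H.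
  assert (K : forall g (p : f = g), Q g (happly !p)) by (intros ? []; exact q).
  refine (transport (fun p => Q g (happly p)) _ (K _ !p)).
  destruct p. exact idpath.
Qed.

(* Dependent paths over 1-, 2- and 3-dimensional paths of the base. *)
Definition dpath1 {X : Type} (P : X -> Type) {x y : X} (p : x = y) (u : P x) (v : P y) : Type :=
  transport P p u = v.

Arguments dpath1 {X} P {x y} p u v.
Definition dpath2 {X : Type} {P : X -> Type} {x y : X} {p q : x = y} (e : p = q)
  {u : P x} {v : P y} (s : dpath1 P p u v) (t : dpath1 P q u v) : Type :=
  transport (fun r => dpath1 P r u v) e s = t.

Definition dpath3 {X : Type} {P : X -> Type} {x y : X} {p q : x = y} {e e' : p = q} (E : e = e')
  {u : P x} {v : P y} {s : dpath1 P p u v} {t : dpath1 P q u v}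
  (m : dpath2 e s t) (m' : dpath2 e' s t) : Type :=
  transport (fun e => dpath2 e s t) E m = m'.

Definition dconcat2 {X : Type} {P : X -> Type} {x y : X} {p q r : x = y} {e : p = q} {e' : q = r}
  {u : P x} {v : P y} {s : dpath1 P p u v} {t : dpath1 P q u v} {w : dpath1 P r u v}
  (m : dpath2 e s t) (m' : dpath2 e' t w) : dpath2 (e @ e') s w.
Proof. destruct m, m', e', e. exact idpath. Defined.

Definition apd1 {X : Type} {P : X -> Type} (f : forall x, P x) {x y : X} (p : x = y) :
  dpath1 P p (f x) (f y) := apd f p.

Definition apd2 {X : Type} {P : X -> Type} (f : forall x, P x) {x y : X} {p q : x = y}
  (e : p = q) : dpath2 e (apd1 f p) (apd1 f q) := apd (fun r => apd1 f r) e.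

Definition apd3 {X : Type} {P : X -> Type} (f : forall x, P x) {x y : X} {p q : x = y}
  {e e' : p = q} (E : e = e') : dpath3 E (apd2 f e) (apd2 f e') := apd (fun r => apd2 f r) E.

Definition apd2_pp {X : Type} {P : X -> Type} (f : forall x, P x) {x y : X} {p q r : x = y}
  (e : p = q) (e' : q = r) : apd2 f (e @ e') = dconcat2 (apd2 f e) (apd2 f e').
Proof. destruct e', e. exact idpath. Defined.

Definition const1 {X Y : Type} {x y : X} (p : x = y) {u v : Y} (s : u = v) :
  dpath1 (fun _ => Y) p u v.
Proof. destruct p. exact s. Defined.

Definition const2 {X Y : Type} {x y : X} {p q : x = y} (e : p = q) {u v : Y} {s t : u = v}
  (m : s = t) : dpath2 e (const1 p s) (const1 q t).
Proof. destruct e. exact (ap (const1 p) m). Defined.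

Definition const3 {X Y : Type} {x y : X} {p q r : x = y} {e1 : p = q} {e2 : q = r} {e3 : p = r}
  (E : e3 = e1 @ e2) {u v : Y} {s t w : u = v} {m1 : s = t} {m2 : t = w} {m3 : s = w}
  (M : m3 = m1 @ m2) :
  dpath3 E (const2 e3 m3) (dconcat2 (const2 e1 m1) (const2 e2 m2)).
Proof.
  assert (K : const2 (e1 @ e2) (m1 @ m2) = dconcat2 (const2 e1 m1) (const2 e2 m2))
    by (destruct m1, m2, e2, e1; exact idpath).
  refine (_ @ K). clear K. destruct E, M. exact idpath.
Defined.

Definition unconst1 {X Y : Type} {x y : X} {p : x = y} {u v : Y} :
  dpath1 (fun _ => Y) p u v -> u = v :=
  match p with idpath => fun s => s end.

Definition unconst2 {X Y : Type} {x y : X} {p q : x = y} {e : p = q} {u v : Y}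
  {s : dpath1 (fun _ => Y) p u v} {t : dpath1 (fun _ => Y) q u v} (m : dpath2 e s t) :
  unconst1 s = unconst1 t.
Proof. destruct e. exact (ap unconst1 m). Defined.

Definition unconst3 {X Y : Type} {x y : X} {p q r : x = y} {e1 : p = q} {e2 : q = r} {e3 : p = r}
  {E : e3 = e1 @ e2} {u v : Y} {s : dpath1 (fun _ => Y) p u v} {t : dpath1 (fun _ => Y) q u v}
  {w : dpath1 (fun _ => Y) r u v} {m1 : dpath2 e1 s t} {m2 : dpath2 e2 t w} {m3 : dpath2 e3 s w}
  (M : dpath3 E m3 (dconcat2 m1 m2)) : unconst2 m3 = unconst2 m1 @ unconst2 m2.
Proof.
  assert (K : unconst2 (dconcat2 m1 m2) = unconst2 m1 @ unconst2 m2)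
    by (destruct m2, m1, e2, e1; exact idpath).
  refine (_ @ K). destruct M. clear K m1 m2.
  revert E m3. generalize (e1 @ e2). intros e [] m3. exact idpath.
Defined.

(* [sq a b s s'] is the type of squares with sides [a], [b], [s], [s'], defined so that it reduces
   to [s = s'] when [a] and [b] are [idpath]; [sq2] and [sq3] are the two next dimensions. *)
Definition sq {X : Type} {u v u' v' : X} (a : u = u') (b : v = v') :
  u = v -> u' = v' -> Type :=
  match a, b with idpath, idpath => fun s s' => s = s' end.

Definition sq2 {X : Type} {u v u' v' : X} {a : u = u'} {b : v = v'}
  {s t : u = v} {s' t' : u' = v'} : sq a b s s' -> sq a b t t' -> s = t -> s' = t' -> Type :=
  match a as a in _ = u' , b as b in _ = v'
    return forall s' t' : u' = v', sq a b s s' -> sq a b t t' -> s = t -> s' = t' -> Type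
  with idpath, idpath => fun s' t' k k' => sq k k' end s' t'.

Definition sq3 {X : Type} {u v u' v' : X} {a : u = u'} {b : v = v'}
  {s t w : u = v} {s' t' w' : u' = v'}
  {k : sq a b s s'} {l : sq a b t t'} {n : sq a b w w'}
  {m1 : s = t} {m2 : t = w} {m3 : s = w} {m1' : s' = t'} {m2' : t' = w'} {m3' : s' = w'}
  (c1 : sq2 k l m1 m1') (c2 : sq2 l n m2 m2') (c3 : sq2 k n m3 m3')
  (M : m3 = m1 @ m2) (M' : m3' = m1' @ m2') : Type.
Proof.
  destruct a, b; cbn in *. destruct k, l, n; cbn in *. destruct c1, c2, c3.
  exact (M = M').
Defined.

Definition paths_rect_r {A : Type} (y : A) (Q : forall x, x = y -> Type) (q : Q y idpath)
  x (p : x = y) : Q x p.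
Proof. destruct p. exact q. Defined.

Definition nat1 {Z X : Type} {z z' : Z} (e : z = z') {px py : Z -> X}
  (ps : forall z, px z = py z) : sq (ap px e) (ap py e) (ps z) (ps z') :=
  match e with idpath => idpath end.

Definition nat2 {Z X : Type} {z z' : Z} (e : z = z') {px py : Z -> X}
  {ps pt : forall z, px z = py z} (pm : forall z, ps z = pt z) :
  sq2 (nat1 e ps) (nat1 e pt) (pm z) (pm z').
Proof. destruct e. exact idpath. Defined.

Definition nat3 {Z X : Type} {z z' : Z} (e : z = z') {px py : Z -> X}
  {ps pt pw : forall z, px z = py z} {pm1 : forall z, ps z = pt z}
  {pm2 : forall z, pt z = pw z} {pm3 : forall z, ps z = pw z}
  (pM : forall z, pm3 z = pm1 z @ pm2 z) :
  sq3 (nat2 e pm1) (nat2 e pm2) (nat2 e pm3) (pM z) (pM z').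
Proof. destruct e. exact idpath. Defined.

Definition conv {X : Type} {u v : X} {x y : u = v} (c : x @ idpath = idpath @ y) : x = y :=
  !(concat_p1 x) @ c.

Definition sq_concat {X : Type} {u v u' v' : X} {a : u = u'} {b : v = v'}
  {s : u = v} {s' : u' = v'} (k : sq a b s s') : a @ s' = s @ b.
Proof. destruct a, b. cbn in k. destruct k. exact (!(concat_p1 _)). Defined.

Definition sq_conv {X : Type} {u u' : X} {a b : u = u'} (k : sq a b idpath idpath) : a = b :=
  conv (sq_concat k).

Definition sq2_concat {X : Type} {u v u' v' : X} {a : u = u'} {b : v = v'}
  {s t : u = v} {s' t' : u' = v'} {k : sq a b s s'} {l : sq a b t t'} {m : s = t} {m' : s' = t'}
  (c : sq2 k l m m') : sq_concat k @ ap (fun s => s @ b) m = ap (fun s => a @ s) m' @ sq_concat l.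
Proof.
  destruct a, b. cbn in *. destruct k, l. cbn in c. destruct c. destruct m. cbn.
  exact (concat_p1 _).
Defined.

Definition sq2_conv {X : Type} {u u' : X} {a b : u = u'} {k l : sq a b idpath idpath}
  (c : sq2 k l idpath idpath) : sq_concat k = sq_concat l := !(concat_p1 _) @ sq2_concat c.

Definition paste {X : Type} {u v u' v' : X} {a : u = u'} {b : v = v'}
  {s t w : u = v} {s' t' w' : u' = v'}
  {k : a @ s' = s @ b} {l : a @ t' = t @ b} {n : a @ w' = w @ b}
  {m1 : s = t} {m2 : t = w} {m1' : s' = t'} {m2' : t' = w'}
  (c1 : k @ ap (fun s => s @ b) m1 = ap (fun s => a @ s) m1' @ l)
  (c2 : l @ ap (fun s => s @ b) m2 = ap (fun s => a @ s) m2' @ n) :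
  k @ ap (fun s => s @ b) (m1 @ m2) = ap (fun s => a @ s) (m1' @ m2') @ n.
Proof.
  destruct m2, m1, m2', m1'. cbn in *.
  exact (c1 @ !(concat_p1 _) @ c2).
Defined.

Lemma sq3_concat {X : Type} {u v u' v' : X} {a : u = u'} {b : v = v'}
  {s t w : u = v} {s' t' w' : u' = v'}
  {k : sq a b s s'} {l : sq a b t t'} {n : sq a b w w'}
  {m1 : s = t} {m2 : t = w} {m3 : s = w} {m1' : s' = t'} {m2' : t' = w'} {m3' : s' = w'}
  {c1 : sq2 k l m1 m1'} {c2 : sq2 l n m2 m2'} {c3 : sq2 k n m3 m3'}
  {M : m3 = m1 @ m2} {M' : m3' = m1' @ m2'} (C : sq3 c1 c2 c3 M M') :
  transport (fun m => _ @ ap (fun s => s @ b) m = _) M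
    (transport (fun m' => _ = ap (fun s => a @ s) m' @ _) M' (sq2_concat c3))
  = paste (sq2_concat c1) (sq2_concat c2).
Proof.
  destruct a, b. cbn in *. destruct k, l, n. cbn in *. destruct c1, c2, c3. destruct C.
  revert m3 M. refine (paths_rect_r _ _ _). destruct m2, m1. cbn.
  assert (K : forall (T : Type) (x y : T) (p : x = y), p = p @ !p @ p)
    by (intros ? ? ? []; exact idpath).
  apply K.
Qed.

Definition apT {X Y : Type} (h : X -> Y) {x y : X} {p q r : x = y} {e1 : p = q} {e2 : q = r}
  {e3 : p = r} (E : e3 = e1 @ e2) : ap (ap h) e3 = ap (ap h) e1 @ ap (ap h) e2 :=
  ap (ap (ap h)) E @ ap_pp (ap h) e1 e2.

Definition eq1 {X Y : Type} {h k : X -> Y} {x y : X} {p : x = y}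
  {a : h x = k x} {b : h y = k y} (c : sq a b (ap h p) (ap k p)) :
  dpath1 (fun t => h t = k t) p a b.
Proof. destruct p. exact (conv (sq_concat c)). Defined.

Definition eq2 {X Y : Type} {h k : X -> Y} {x y : X} {p q : x = y} {e : p = q}
  {a : h x = k x} {b : h y = k y} {c : sq a b (ap h p) (ap k p)} {d : sq a b (ap h q) (ap k q)}
  (m : sq2 c d (ap (ap h) e) (ap (ap k) e)) : dpath2 e (eq1 c) (eq1 d).
Proof. destruct e, p. exact (ap conv (sq2_conv m)). Defined.

Lemma eq3_aux {X : Type} {u u' : X} {a b : u = u'} {k l n : a @ idpath = idpath @ b}
  (c1 : k @ idpath = l) (c2 : l @ idpath = n) :
  ap conv (!(concat_p1 k) @ paste (s := idpath) (t := idpath) (w := idpath)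
    (s' := idpath) (t' := idpath) (w' := idpath) (m1 := idpath) (m2 := idpath)
    (m1' := idpath) (m2' := idpath) c1 c2)
  = ap conv (!(concat_p1 k) @ c1) @ ap conv (!(concat_p1 l) @ c2).
Proof.
  destruct c2, c1. cbn in k |- *. destruct k. exact idpath.
Qed.

Lemma eq3 {X Y : Type} {h k : X -> Y} {x y : X} {p q r : x = y} {e1 : p = q} {e2 : q = r}
  {e3 : p = r} {E : e3 = e1 @ e2} {a : h x = k x} {b : h y = k y}
  {c : sq a b (ap h p) (ap k p)} {d : sq a b (ap h q) (ap k q)} {f : sq a b (ap h r) (ap k r)}
  {m1 : sq2 c d (ap (ap h) e1) (ap (ap k) e1)} {m2 : sq2 d f (ap (ap h) e2) (ap (ap k) e2)}
  {m3 : sq2 c f (ap (ap h) e3) (ap (ap k) e3)}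
  (C : sq3 m1 m2 m3 (apT h E) (apT k E)) :
  dpath3 E (eq2 m3) (dconcat2 (eq2 m1) (eq2 m2)).
Proof.
  apply sq3_concat in C. revert e3 E m3 C. refine (paths_rect_r _ _ _). intros m3 C.
  destruct e2, e1, p. cbn in *.
  unfold sq2_conv. refine (ap (fun z => ap conv (_ @ z)) C @ _).
  assert (K : forall (P : X -> Type) (u v : P x) (s t w : u = v) (m : s = t) (m' : t = w),
    m @ m' = dconcat2 (P := P) (p := idpath) (e := idpath) (e' := idpath) m m')
    by (intros P u v s t w [] []; exact idpath).
  refine (_ @ K (fun t => h t = k t) _ _ _ _ _ _ _). apply eq3_aux.
Qed.

Set Implicit Arguments.
Record pType := { pcarrier :> Type; pt : pcarrier }.
Unset Implicit Arguments.
Arguments pt {p}.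
(* Equality of pointed maps is [=] in this dependent sum, which includes the pointing path. *)
Set Implicit Arguments.
Record pMap (A B : pType) := { pfun :> A -> B; point_eq : pfun pt = pt }.
Unset Implicit Arguments.
Arguments Build_pMap {A B} pfun point_eq.

(* [smash_alg A B X] is the type of tuples of constructors of the smash product, with values
   in [X]; [smash_dalg s P] is its dependent version, the premises of the induction principle. *)
Set Implicit Arguments.
Record smash_alg (A B : pType) (X : Type) := {
  sa_base : X;
  sa_pair : A -> B -> X;
  sa_pushl : forall a, sa_pair a pt = sa_base;
  sa_pushr : forall b, sa_pair pt b = sa_base;
  sa_pushlr : sa_pushl pt = sa_pushr pt }.
Unset Implicit Arguments.
Arguments Build_smash_alg {A B X} sa_base sa_pair sa_pushl sa_pushr sa_pushlr.

Set Implicit Arguments.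
Record smash_dalg (A B : pType) (X : Type) (s : smash_alg A B X) (P : X -> Type) := {
  sd_base : P (sa_base s);
  sd_pair : forall a b, P (sa_pair s a b);
  sd_pushl : forall a, dpath1 P (sa_pushl s a) (sd_pair a pt) sd_base;
  sd_pushr : forall b, dpath1 P (sa_pushr s b) (sd_pair pt b) sd_base;
  sd_pushlr : dpath2 (sa_pushlr s) (sd_pushl pt) (sd_pushr pt) }.
Unset Implicit Arguments.

Definition smash_apd {A B : pType} {X : Type} (s : smash_alg A B X) {P : X -> Type}
  (f : forall x, P x) : smash_dalg s P := {|
  sd_base := f (sa_base s);
  sd_pair := fun a b => f (sa_pair s a b);
  sd_pushl := fun a => apd1 f (sa_pushl s a);
  sd_pushr := fun b => apd1 f (sa_pushr s b);
  sd_pushlr := apd2 f (sa_pushlr s) |}.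

(* A type with the constructors and the induction principle of the higher inductive type
   A /\ B, eliminating into arbitrary type families. All the computation rules are
   propositional and are packaged in the single path [smash_beta] between dependent tuples. *)
Set Implicit Arguments.
Record Smash (A B : pType) := {
  smash_type : Type;
  smash_str : smash_alg A B smash_type;
  smash_ind : forall P : smash_type -> Type, smash_dalg smash_str P -> forall x, P x;
  smash_beta : forall (P : smash_type -> Type) (d : smash_dalg smash_str P),
    smash_apd smash_str (smash_ind d) = d }.
Unset Implicit Arguments.
Arguments smash_ind {A B} s P _ x.
Arguments smash_beta {A B} s P d.

Definition smash_map {A B : pType} {X Y : Type} (h : X -> Y) (s : smash_alg A B X) :
  smash_alg A B Y := {|
  sa_base := h (sa_base s);
  sa_pair := fun a b => h (sa_pair s a b);
  sa_pushl := fun a => ap h (sa_pushl s a);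
  sa_pushr := fun b => ap h (sa_pushr s b);
  sa_pushlr := ap (ap h) (sa_pushlr s) |}.

Definition smash_const {A B : pType} {X Y : Type} (s : smash_alg A B X) (d : smash_alg A B Y) :
  smash_dalg s (fun _ => Y) := {|
  sd_base := sa_base d;
  sd_pair := sa_pair d;
  sd_pushl := fun a => const1 (sa_pushl s a) (sa_pushl d a);
  sd_pushr := fun b => const1 (sa_pushr s b) (sa_pushr d b);
  sd_pushlr := const2 (sa_pushlr s) (sa_pushlr d) |}.

Definition smash_rec {A B : pType} (S : Smash A B) {Y : Type} (d : smash_alg A B Y) :
  smash_type S -> Y := smash_ind S _ (smash_const (smash_str S) d).

Definition smash_rec_base {A B : pType} (S : Smash A B) {Y : Type} (d : smash_alg A B Y) :
  smash_rec S d (sa_base (smash_str S)) = sa_base d :=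
  ap (fun e => sd_base e) (smash_beta S _ (smash_const (smash_str S) d)).

Definition smash_eval {A B : pType} (S : Smash A B) {Y : Type} (h : smash_type S -> Y) :
  smash_alg A B Y := smash_map h (smash_str S).

Lemma smash_congr (fe : Funext) {A B : pType} {X T : Type} {x0 : X} {pair : A -> B -> X}
  (G : forall (pl : forall a, pair a pt = x0) (pr : forall b, pair pt b = x0),
     pl pt = pr pt -> T)
  {pl pl' : forall a, pair a pt = x0} {pr pr' : forall b, pair pt b = x0}
  {plr : pl pt = pr pt} {plr' : pl' pt = pr' pt}
  (Hl : forall a, pl a = pl' a) (Hr : forall b, pr b = pr' b)
  (Hlr : sq (Hl pt) (Hr pt) plr plr') : G pl pr plr = G pl' pr' plr'.
Proof.
  revert plr plr' Hlr.
  refine (htpy_ind fe _ (fun pl' Hl => forall plr plr' (Hlr : sq (Hl pt) (Hr pt) plr plr'),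
    G pl pr plr = G pl' pr' plr') _ _ Hl).
  refine (htpy_ind fe _ (fun pr' Hr => forall plr plr' (Hlr : sq idpath (Hr pt) plr plr'),
    G pl pr plr = G pl pr' plr') _ _ Hr).
  intros plr plr' H. exact (ap (G pl pr) H).
Qed.

Definition smash_unconst {A B : pType} {X Y : Type} {s : smash_alg A B X}
  (d : smash_dalg s (fun _ => Y)) : smash_alg A B Y := {|
  sa_base := sd_base d;
  sa_pair := sd_pair d;
  sa_pushl := fun a => unconst1 (sd_pushl d a);
  sa_pushr := fun b => unconst1 (sd_pushr d b);
  sa_pushlr := unconst2 (sd_pushlr d) |}.

Definition cube {X : Type} {u v : X} {s t w s' t' w' : u = v}
  {k : s = s'} {l : t = t'} {n : w = w'}
  {m1 : s = t} {m2 : t = w} {m3 : s = w} {m1' : s' = t'} {m2' : t' = w'} {m3' : s' = w'}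
  (c1 : sq k l m1 m1') (c2 : sq l n m2 m2') (c3 : sq k n m3 m3')
  (M : m3 = m1 @ m2) (M' : m3' = m1' @ m2') : Type :=
  sq3 (a := idpath) (b := idpath) (k := k) (l := l) (n := n) c1 c2 c3 M M'.

Lemma unconst1_const1 {X Y : Type} {x y : X} (p : x = y) {u v : Y} (s : u = v) :
  unconst1 (const1 p s) = s.
Proof. destruct p. exact idpath. Defined.

Lemma unconst2_const2 {X Y : Type} {x y : X} {p q : x = y} (e : p = q) {u v : Y} {s t : u = v}
  (m : s = t) : sq (unconst1_const1 p s) (unconst1_const1 q t) (unconst2 (const2 e m)) m.
Proof. destruct m, e, p. exact idpath. Defined.

Lemma unconst3_const3 {X Y : Type} {x y : X} {p q r : x = y} {e1 : p = q} {e2 : q = r} {e3 : p = r}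
  (E : e3 = e1 @ e2) {u v : Y} {s t w : u = v} {m1 : s = t} {m2 : t = w} {m3 : s = w}
  (M : m3 = m1 @ m2) :
  cube (unconst2_const2 e1 m1) (unconst2_const2 e2 m2) (unconst2_const2 e3 m3)
    (unconst3 (const3 E M)) M.
Proof.
  revert m3 M. refine (paths_rect_r _ _ _). revert e3 E. refine (paths_rect_r _ _ _).
  destruct m2, m1, e2, e1, p. exact idpath.
Defined.

Lemma unconst1_apd {X Y : Type} (h : X -> Y) {x y : X} (p : x = y) :
  unconst1 (apd1 h p) = ap h p.
Proof. destruct p. exact idpath. Defined.

Lemma unconst2_apd {X Y : Type} (h : X -> Y) {x y : X} {p q : x = y} (e : p = q) :
  sq (unconst1_apd h p) (unconst1_apd h q) (unconst2 (apd2 h e)) (ap (ap h) e).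
Proof. destruct e, p. exact idpath. Defined.

Definition apd3T {X : Type} {P : X -> Type} (f : forall x, P x) {x y : X} {p q r : x = y}
  {e1 : p = q} {e2 : q = r} {e3 : p = r} (E : e3 = e1 @ e2) :
  dpath3 E (apd2 f e3) (dconcat2 (apd2 f e1) (apd2 f e2)) := apd3 f E @ apd2_pp f e1 e2.

Lemma unconst3_apd {X Y : Type} (h : X -> Y) {x y : X} {p q r : x = y}
  {e1 : p = q} {e2 : q = r} {e3 : p = r} (E : e3 = e1 @ e2) :
  cube (unconst2_apd h e1) (unconst2_apd h e2) (unconst2_apd h e3)
    (unconst3 (apd3T h E)) (apT h E).
Proof. revert e3 E. refine (paths_rect_r _ _ _). destruct e2, e1, p. exact idpath. Defined.

Lemma smash_rec_beta (fe : Funext) {A B : pType} (S : Smash A B) {Y : Type}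
  (d : smash_alg A B Y) : smash_eval S (smash_rec S d) = d.
Proof.
  refine (_ @ (ap smash_unconst (smash_beta S _ (smash_const (smash_str S) d)) @ _)).
  - set (h := smash_rec S d). change (smash_eval S h = smash_unconst (smash_apd (smash_str S) h)).
    refine (!_).
    refine (smash_congr fe (fun pl pr plr => Build_smash_alg _ _ pl pr plr)
      (fun a => unconst1_apd h (sa_pushl (smash_str S) a))
      (fun b => unconst1_apd h (sa_pushr (smash_str S) b))
      (unconst2_apd h (sa_pushlr (smash_str S)))).
  - refine (smash_congr fe (fun pl pr plr => Build_smash_alg _ _ pl pr plr)
      (fun a => unconst1_const1 (sa_pushl (smash_str S) a) (sa_pushl d a))
      (fun b => unconst1_const1 (sa_pushr (smash_str S) b) (sa_pushr d b))
      (unconst2_const2 (sa_pushlr (smash_str S)) (sa_pushlr d))).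
Qed.

Lemma smash_uniq {A B : pType} (S : Smash A B) {Y : Type} (h k : smash_type S -> Y)
  (e : smash_eval S h = smash_eval S k) : forall x, h x = k x.
Proof.
  refine (smash_ind S (fun x => h x = k x)
    {| sd_base := ap (fun d => sa_base d) e;
       sd_pair := fun a b => ap (fun d => sa_pair d a b) e;
       sd_pushl := fun a => eq1 (nat1 e (fun d => sa_pushl d a));
       sd_pushr := fun b => eq1 (nat1 e (fun d => sa_pushr d b));
       sd_pushlr := eq2 (nat2 e (fun d => sa_pushlr d)) |}).
Qed.

Lemma htpy_ind2 (fe : Funext) {A : Type} {B : A -> Type} {P : forall a, B a -> Type}
  (f : forall a b, P a b)
  (Q : forall g, (forall a b, f a b = g a b) -> Type) (q : Q f (fun a b => idpath)) g H : Q g H.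
Proof.
  refine (transport (Q g) (funext fe (fun a => eisretr (fe _ _ (f a) (g a)) (H a)))
    ((_ : forall K : (forall a, f a = g a), Q g (fun a => happly (K a)))
      (fun a => equiv_inv (fe _ _ (f a) (g a)) (H a)))).
  clear H. intro K.
  refine (htpy_ind fe f (fun g K => Q g (fun a => happly (K a))) q g K).
Qed.

Lemma htpy_ind2_r (fe : Funext) {A : Type} {B : A -> Type} {P : forall a, B a -> Type}
  (f : forall a b, P a b)
  (Q : forall g, (forall a b, g a b = f a b) -> Type) (q : Q f (fun a b => idpath)) g H : Q g H.
Proof.
  refine (transport (Q g) (funext fe (fun a => eisretr (fe _ _ (g a) (f a)) (H a)))
    ((_ : forall K : (forall a, g a = f a), Q g (fun a => happly (K a)))
      (fun a => equiv_inv (fe _ _ (g a) (f a)) (H a)))).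
  clear H. intro K.
  refine (htpy_ind_r fe f (fun g K => Q g (fun a => happly (K a))) q g K).
Qed.

Set Implicit Arguments.
Record smash3_alg (A B C : pType) (X : Type) := {
  s3_base : X;
  s3_tri : A -> B -> C -> X;
  s3_push0 : forall b c, s3_tri pt b c = s3_base;
  s3_push1 : forall a c, s3_tri a pt c = s3_base;
  s3_push2 : forall a b, s3_tri a b pt = s3_base;
  s3_push12 : forall a, s3_push1 a pt = s3_push2 a pt;
  s3_push02 : forall b, s3_push0 b pt = s3_push2 pt b;
  s3_push01 : forall c, s3_push0 pt c = s3_push1 pt c;
  s3_push012 : s3_push02 pt = s3_push01 pt @ s3_push12 pt }.

Record smash3_dalg (A B C : pType) (X : Type) (s : smash3_alg A B C X) (P : X -> Type) := {
  s3d_base : P (s3_base s);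
  s3d_tri : forall a b c, P (s3_tri s a b c);
  s3d_push0 : forall b c, dpath1 P (s3_push0 s b c) (s3d_tri pt b c) s3d_base;
  s3d_push1 : forall a c, dpath1 P (s3_push1 s a c) (s3d_tri a pt c) s3d_base;
  s3d_push2 : forall a b, dpath1 P (s3_push2 s a b) (s3d_tri a b pt) s3d_base;
  s3d_push12 : forall a, dpath2 (s3_push12 s a) (s3d_push1 a pt) (s3d_push2 a pt);
  s3d_push02 : forall b, dpath2 (s3_push02 s b) (s3d_push0 b pt) (s3d_push2 pt b);
  s3d_push01 : forall c, dpath2 (s3_push01 s c) (s3d_push0 pt c) (s3d_push1 pt c);
  s3d_push012 : dpath3 (s3_push012 s) (s3d_push02 pt)
    (dconcat2 (s3d_push01 pt) (s3d_push12 pt)) }.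
Unset Implicit Arguments.
Arguments Build_smash3_alg {A B C X} s3_base s3_tri s3_push0 s3_push1 s3_push2
  s3_push12 s3_push02 s3_push01 s3_push012.

Definition smash3_apd {A B C : pType} {X : Type} (s : smash3_alg A B C X) {P : X -> Type}
  (f : forall x, P x) : smash3_dalg s P := {|
  s3d_base := f (s3_base s);
  s3d_tri := fun a b c => f (s3_tri s a b c);
  s3d_push0 := fun b c => apd1 f (s3_push0 s b c);
  s3d_push1 := fun a c => apd1 f (s3_push1 s a c);
  s3d_push2 := fun a b => apd1 f (s3_push2 s a b);
  s3d_push12 := fun a => apd2 f (s3_push12 s a);
  s3d_push02 := fun b => apd2 f (s3_push02 s b);
  s3d_push01 := fun c => apd2 f (s3_push01 s c);
  s3d_push012 := apd3T f (s3_push012 s) |}.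

(* The higher inductive type /\(A,B,C), presented in the same way as [Smash]. The component
   [apd3T] of [smash3_apd] is the action on the 3-path, re-expressed by [apd2_pp] over the
   composite of two 2-paths. *)
Set Implicit Arguments.
Record Smash3 (A B C : pType) := {
  smash3_type : Type;
  smash3_str : smash3_alg A B C smash3_type;
  smash3_ind : forall P : smash3_type -> Type, smash3_dalg smash3_str P -> forall x, P x;
  smash3_beta : forall (P : smash3_type -> Type) (d : smash3_dalg smash3_str P),
    smash3_apd smash3_str (smash3_ind d) = d }.
Unset Implicit Arguments.
Arguments smash3_ind {A B C} s P _ x.
Arguments smash3_beta {A B C} s P d.

Definition smash3_map {A B C : pType} {X Y : Type} (h : X -> Y) (s : smash3_alg A B C X) :
  smash3_alg A B C Y := {|
  s3_base := h (s3_base s);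
  s3_tri := fun a b c => h (s3_tri s a b c);
  s3_push0 := fun b c => ap h (s3_push0 s b c);
  s3_push1 := fun a c => ap h (s3_push1 s a c);
  s3_push2 := fun a b => ap h (s3_push2 s a b);
  s3_push12 := fun a => ap (ap h) (s3_push12 s a);
  s3_push02 := fun b => ap (ap h) (s3_push02 s b);
  s3_push01 := fun c => ap (ap h) (s3_push01 s c);
  s3_push012 := apT h (s3_push012 s) |}.

Definition smash3_const {A B C : pType} {X Y : Type} (s : smash3_alg A B C X) (d : smash3_alg A B C Y) :
  smash3_dalg s (fun _ => Y) := {|
  s3d_base := s3_base d;
  s3d_tri := s3_tri d;
  s3d_push0 := fun b c => const1 (s3_push0 s b c) (s3_push0 d b c);
  s3d_push1 := fun a c => const1 (s3_push1 s a c) (s3_push1 d a c);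
  s3d_push2 := fun a b => const1 (s3_push2 s a b) (s3_push2 d a b);
  s3d_push12 := fun a => const2 (s3_push12 s a) (s3_push12 d a);
  s3d_push02 := fun b => const2 (s3_push02 s b) (s3_push02 d b);
  s3d_push01 := fun c => const2 (s3_push01 s c) (s3_push01 d c);
  s3d_push012 := const3 (s3_push012 s) (s3_push012 d) |}.

Definition smash3_rec {A B C : pType} (T : Smash3 A B C) {Y : Type} (d : smash3_alg A B C Y) :
  smash3_type T -> Y := smash3_ind T _ (smash3_const (smash3_str T) d).

Definition smash3_rec_base {A B C : pType} (T : Smash3 A B C) {Y : Type} (d : smash3_alg A B C Y) :
  smash3_rec T d (s3_base (smash3_str T)) = s3_base d :=
  ap (fun e => s3d_base e) (smash3_beta T _ (smash3_const (smash3_str T) d)).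

Definition smash3_eval {A B C : pType} (T : Smash3 A B C) {Y : Type} (h : smash3_type T -> Y) :
  smash3_alg A B C Y := smash3_map h (smash3_str T).

Lemma smash3_congr (fe : Funext) {A B C : pType} {X : Type} {x0 : X} {tri : A -> B -> C -> X}
  {p0 p0' : forall b c, tri pt b c = x0}
  {p1 p1' : forall a c, tri a pt c = x0}
  {p2 p2' : forall a b, tri a b pt = x0}
  {p12 : forall a, p1 a pt = p2 a pt} {p12' : forall a, p1' a pt = p2' a pt}
  {p02 : forall b, p0 b pt = p2 pt b} {p02' : forall b, p0' b pt = p2' pt b}
  {p01 : forall c, p0 pt c = p1 pt c} {p01' : forall c, p0' pt c = p1' pt c}
  {p012 : p02 pt = p01 pt @ p12 pt} {p012' : p02' pt = p01' pt @ p12' pt}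
  (H0 : forall b c, p0 b c = p0' b c)
  (H1 : forall a c, p1 a c = p1' a c)
  (H2 : forall a b, p2 a b = p2' a b)
  (K12 : forall a, sq (H1 a pt) (H2 a pt) (p12 a) (p12' a))
  (K02 : forall b, sq (H0 b pt) (H2 pt b) (p02 b) (p02' b))
  (K01 : forall c, sq (H0 pt c) (H1 pt c) (p01 c) (p01' c))
  (L : cube (K01 pt) (K12 pt) (K02 pt) p012 p012') :
  Build_smash3_alg x0 tri p0 p1 p2 p12 p02 p01 p012
  = Build_smash3_alg x0 tri p0' p1' p2' p12' p02' p01' p012'.
Proof.
  revert p02' p01' p12' p012' K12 K02 K01 L.
  refine (htpy_ind2 fe _ (fun p0' H0 =>
    forall p02' p01' p12' p012' (K12 : forall a, sq (H1 a pt) (H2 a pt) (p12 a) (p12' a))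
      (K02 : forall b, sq (H0 b pt) (H2 pt b) (p02 b) (p02' b))
      (K01 : forall c, sq (H0 pt c) (H1 pt c) (p01 c) (p01' c))
      (L : cube (K01 pt) (K12 pt) (K02 pt) p012 p012'), _) _ _ H0).
  refine (htpy_ind2 fe _ (fun p1' H1 =>
    forall p02' p01' p12' p012' (K12 : forall a, sq (H1 a pt) (H2 a pt) (p12 a) (p12' a))
      (K02 : forall b, sq idpath (H2 pt b) (p02 b) (p02' b))
      (K01 : forall c, sq idpath (H1 pt c) (p01 c) (p01' c))
      (L : cube (k := idpath) (K01 pt) (K12 pt) (K02 pt) p012 p012'), _) _ _ H1).
  refine (htpy_ind2 fe _ (fun p2' H2 =>
    forall p02' p01' p12' p012' (K12 : forall a, sq idpath (H2 a pt) (p12 a) (p12' a))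
      (K02 : forall b, sq idpath (H2 pt b) (p02 b) (p02' b))
      (K01 : forall c, sq idpath idpath (p01 c) (p01' c))
      (L : cube (k := idpath) (l := idpath) (K01 pt) (K12 pt) (K02 pt) p012 p012'), _) _ _ H2).
  intros p02' p01' p12' p012' K12 K02 K01 L. cbn in K12, K02, K01.
  revert p012' L.
  refine (htpy_ind fe _ (fun p12' K12 => forall p012'
    (L : cube (k := idpath) (l := idpath) (n := idpath) (K01 pt) (K12 pt) (K02 pt) p012 p012'),
    _) _ _ K12).
  refine (htpy_ind fe _ (fun p02' K02 => forall p012'
    (L : cube (k := idpath) (l := idpath) (n := idpath) (K01 pt) idpath (K02 pt) p012 p012'),
    _) _ _ K02).
  refine (htpy_ind fe _ (fun p01' K01 => forall p012'
    (L : cube (k := idpath) (l := idpath) (n := idpath) (K01 pt) idpath idpath p012 p012'),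
    _) _ _ K01).
  intros p012' L. cbn in L. destruct L. exact idpath.
Qed.

Definition smash3_unconst {A B C : pType} {X Y : Type} {s : smash3_alg A B C X}
  (d : smash3_dalg s (fun _ => Y)) : smash3_alg A B C Y := {|
  s3_base := s3d_base d;
  s3_tri := s3d_tri d;
  s3_push0 := fun b c => unconst1 (s3d_push0 d b c);
  s3_push1 := fun a c => unconst1 (s3d_push1 d a c);
  s3_push2 := fun a b => unconst1 (s3d_push2 d a b);
  s3_push12 := fun a => unconst2 (s3d_push12 d a);
  s3_push02 := fun b => unconst2 (s3d_push02 d b);
  s3_push01 := fun c => unconst2 (s3d_push01 d c);
  s3_push012 := unconst3 (s3d_push012 d) |}.

Lemma smash3_rec_beta (fe : Funext) {A B C : pType} (T : Smash3 A B C) {Y : Type}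
  (d : smash3_alg A B C Y) : smash3_eval T (smash3_rec T d) = d.
Proof.
  set (s := smash3_str T).
  refine (_ @ (ap smash3_unconst (smash3_beta T _ (smash3_const s d)) @ _)).
  - set (h := smash3_rec T d). change (smash3_eval T h = smash3_unconst (smash3_apd s h)).
    refine (! _).
    refine (smash3_congr fe
      (fun b c => unconst1_apd h (s3_push0 s b c))
      (fun a c => unconst1_apd h (s3_push1 s a c))
      (fun a b => unconst1_apd h (s3_push2 s a b))
      (fun a => unconst2_apd h (s3_push12 s a))
      (fun b => unconst2_apd h (s3_push02 s b))
      (fun c => unconst2_apd h (s3_push01 s c))
      (unconst3_apd h (s3_push012 s))).
  - refine (smash3_congr fe
      (fun b c => unconst1_const1 (s3_push0 s b c) (s3_push0 d b c))
      (fun a c => unconst1_const1 (s3_push1 s a c) (s3_push1 d a c))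
      (fun a b => unconst1_const1 (s3_push2 s a b) (s3_push2 d a b))
      (fun a => unconst2_const2 (s3_push12 s a) (s3_push12 d a))
      (fun b => unconst2_const2 (s3_push02 s b) (s3_push02 d b))
      (fun c => unconst2_const2 (s3_push01 s c) (s3_push01 d c))
      (unconst3_const3 (s3_push012 s) (s3_push012 d))).
Qed.

Lemma smash3_uniq {A B C : pType} (T : Smash3 A B C) {Y : Type} (h k : smash3_type T -> Y)
  (e : smash3_eval T h = smash3_eval T k) : forall x, h x = k x.
Proof.
  refine (smash3_ind T (fun x => h x = k x)
    {| s3d_base := ap (fun d => s3_base d) e;
       s3d_tri := fun a b c => ap (fun d => s3_tri d a b c) e;
       s3d_push0 := fun b c => eq1 (nat1 e (fun d => s3_push0 d b c));
       s3d_push1 := fun a c => eq1 (nat1 e (fun d => s3_push1 d a c));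
       s3d_push2 := fun a b => eq1 (nat1 e (fun d => s3_push2 d a b));
       s3d_push12 := fun a => eq2 (nat2 e (fun d => s3_push12 d a));
       s3d_push02 := fun b => eq2 (nat2 e (fun d => s3_push02 d b));
       s3d_push01 := fun c => eq2 (nat2 e (fun d => s3_push01 d c));
       s3d_push012 := eq3 (nat3 e (fun d => s3_push012 d)) |}).
Qed.

Lemma isequiv_compose {A B C : Type} (f : A -> B) (g : B -> C) (ef : IsEquiv f) (eg : IsEquiv g) :
  IsEquiv (fun a => g (f a)).
Proof.
  refine (isequiv_adjointify _ (fun c => equiv_inv ef (equiv_inv eg c)) _ _).
  - intro c. exact (ap g (eisretr ef _) @ eisretr eg c).
  - intro a. exact (ap (equiv_inv ef) (eissect eg _) @ eissect ef a).
Defined.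

Lemma isequiv_sigma_fiber {A : Type} {P R : A -> Type} (g : forall a, P a -> R a)
  (eg : forall a, IsEquiv (g a)) :
  IsEquiv (fun w : sigma P => dpair (P := R) (pr1 w) (g _ (pr2 w))).
Proof.
  refine (isequiv_adjointify _ (fun w => dpair (P := P) (pr1 w) (equiv_inv (eg _) (pr2 w))) _ _).
  - intro w. exact (ap (fun r => dpair (P := R) (pr1 w) r) (eisretr (eg _) (pr2 w))).
  - intro w. exact (ap (fun r => dpair (P := P) (pr1 w) r) (eissect (eg _) (pr2 w))).
Defined.

Lemma isequiv_sigma_base {A B : Type} (f : A -> B) (ef : IsEquiv f) (P : B -> Type) :
  IsEquiv (fun w : sigma (fun a => P (f a)) => dpair (P := P) (f (pr1 w)) (pr2 w)).
Proof.
  refine (isequiv_adjointify _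
    (fun w => dpair (P := fun a => P (f a)) (equiv_inv ef (pr1 w))
       (transport P (!(eisretr ef (pr1 w))) (pr2 w))) _ _).
  - assert (K : forall b b' (q : b = b') (r : P b'),
      dpair (P := P) b (transport P (!q) r) = dpair b' r) by (intros b b' [] r; exact idpath).
    intro w. apply K.
  - assert (K : forall a a' (q : a = a') (r : P (f a')),
      dpair (P := fun a => P (f a)) a (transport P (!(ap f q)) r) = dpair a' r)
      by (intros a a' [] r; exact idpath).
    intro w.
    refine (ap (fun z => dpair (P := fun a => P (f a)) (equiv_inv ef (f (pr1 w)))
      (transport P (!z) (pr2 w))) (eisadj ef (pr1 w)) @ _).
    apply K.
Defined.

Lemma isequiv_sigma {A B : Type} {P : A -> Type} {R : B -> Type} (f : A -> B) (ef : IsEquiv f)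
  (g : forall a, P a -> R (f a)) (eg : forall a, IsEquiv (g a)) :
  IsEquiv (fun w : sigma P => dpair (P := R) (f (pr1 w)) (g _ (pr2 w))).
Proof.
  exact (isequiv_compose _ _ (isequiv_sigma_fiber g eg) (isequiv_sigma_base f ef R)).
Defined.

Lemma isequiv_postcompose (fe : Funext) {C A B : Type} (f : A -> B) (ef : IsEquiv f) :
  IsEquiv (fun (u : C -> A) c => f (u c)).
Proof.
  refine (isequiv_adjointify _ (fun v c => equiv_inv ef (v c)) _ _).
  - intro v. exact (funext fe (fun c => eisretr ef (v c))).
  - intro u. exact (funext fe (fun c => eissect ef (u c))).
Defined.

Lemma isequiv_contr_total {A : Type} {P R : A -> Type} (g : forall a, P a -> R a)
  (c : sigma P) (Pc : forall w, c = w) (d : sigma R) (Rc : forall w, d = w) (a : A) :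
  IsEquiv (g a).
Proof.
  destruct c as [a0 p0].
  pose (d0 := dpair (P := R) a0 (g a0 p0)).
  pose (l := fun w : sigma R => !(Rc d0) @ Rc w).
  assert (l0 : l d0 = idpath) by (unfold l; destruct (Rc d0); exact idpath).
  pose (m := fun (w : sigma R) (q : d0 = w) => transport P (ap (fun w => pr1 w) q) p0 : P (pr1 w)).
  refine (isequiv_adjointify _ (fun r : R a => m (dpair a r) (l (dpair a r)) : P a) _ _).
  - intro r.
    assert (K : forall w q, g (pr1 w) (m w q) = pr2 w) by (intros w []; exact idpath).
    exact (K _ (l (dpair a r))).
  - intro p.
    assert (K : forall w (q : dpair (P := P) a0 p0 = w),
      m (dpair (pr1 w) (g _ (pr2 w))) (l (dpair (pr1 w) (g _ (pr2 w)))) = pr2 w).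
    { intros w []. exact (ap (m d0) l0). }
    exact (K _ (Pc (dpair a p))).
Defined.

Definition pSmash {A B : pType} (S : Smash A B) : pType :=
  {| pcarrier := smash_type S; pt := sa_base (smash_str S) |}.

Lemma isequiv_smash_eval (fe : Funext) {A B : pType} (S : Smash A B) (Y : Type) :
  IsEquiv (fun h : smash_type S -> Y => smash_eval S h).
Proof.
  refine (isequiv_adjointify _ (fun d => smash_rec S d) _ _).
  - intro d. exact (smash_rec_beta fe S d).
  - intro h. exact (funext fe (smash_uniq S _ _ (smash_rec_beta fe S (smash_eval S h)))).
Defined.

Definition slide {S X : Type} {q : S -> X} {x0 : X} (l : forall s, q s = x0) {s s0 : S}
  (p : s = s0) {r : q s0 = x0} : l s0 = r -> ap q p @ r = l s :=
  match p in _ = s0 return forall r : q s0 = x0, l s0 = r -> ap q p @ r = l s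
  with idpath => fun r e => !e end r.

Definition slide_nat {S X : Type} {q : S -> X} {x0 : X} (l : forall s, q s = x0) {s s0 : S}
  {p p' : s = s0} (e : p = p') {r : q s0 = x0} (w : l s0 = r) :
  slide l p' w = !(ap (fun t => t @ r) (ap (ap q) e)) @ slide l p w :=
  match e with idpath => idpath end.

(* If [d] is the tuple of values of a map [h] on the constructors of (A /\ B) /\ C, then
   [assoc_cells S d] lists the values of [h] on the iterated constructors: for instance
   [s3_push1 a c] is the value of [h] on the composite of ap <-,c> (push_l a) with push_r c,
   and [s3_push12 a] the value on ap push_l (push_l a), read as the naturality square [slide].
   Contracting push_r against the base point in this way amounts to sending push_r(c),
   push_l(base) and push_lr to [idpath]. [s3_push01] and [sa_pushlr] have opposite orientations. *)
Definition assoc_cells {A B C : pType} (S : Smash A B) {X : Type}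
  (d : smash_alg (pSmash S) C X) : smash3_alg A B C X :=
  let s := smash_str S in {|
  s3_base := sa_base d;
  s3_tri := fun a b c => sa_pair d (sa_pair s a b) c;
  s3_push0 := fun b c => ap (fun x => sa_pair d x c) (sa_pushr s b) @ sa_pushr d c;
  s3_push1 := fun a c => ap (fun x => sa_pair d x c) (sa_pushl s a) @ sa_pushr d c;
  s3_push2 := fun a b => sa_pushl d (sa_pair s a b);
  s3_push12 := fun a => slide (sa_pushl d) (sa_pushl s a) (sa_pushlr d);
  s3_push02 := fun b => slide (sa_pushl d) (sa_pushr s b) (sa_pushlr d);
  s3_push01 := fun c =>
    !(ap (fun p => p @ sa_pushr d c) (ap (ap (fun x => sa_pair d x c)) (sa_pushlr s)));
  s3_push012 := slide_nat (sa_pushl d) (sa_pushlr s) (sa_pushlr d) |}.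

Set Implicit Arguments.
Record bcells (A B : pType) (X : Type) (x0 : X) := {
  bc_pair : A -> B -> X;
  bc_push1 : forall a, bc_pair a pt = x0;
  bc_push0 : forall b, bc_pair pt b = x0;
  bc_push01 : bc_push0 pt = bc_push1 pt }.

Record ncells (A B : pType) (X : Type) (x0 : X) (d : bcells A B x0) := {
  nc_push2 : forall a b, bc_pair d a b = x0;
  nc_push12 : forall a, bc_push1 d a = nc_push2 a pt;
  nc_push02 : forall b, bc_push0 d b = nc_push2 pt b;
  nc_push012 : nc_push02 pt = bc_push01 d @ nc_push12 pt }.
Unset Implicit Arguments.
Arguments Build_bcells {A B X x0} bc_pair bc_push1 bc_push0 bc_push01.
Arguments Build_ncells {A B X x0 d} nc_push2 nc_push12 nc_push02 nc_push012.

Definition bmaps {A B : pType} (S : Smash A B) {X : Type} (x0 : X) : Type :=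
  sigma (fun h : smash_type S -> X => h (sa_base (smash_str S)) = x0).

Definition nmaps {A B : pType} {S : Smash A B} {X : Type} {x0 : X} (Q : bmaps S x0) : Type :=
  sigma (fun n : forall s, pr1 Q s = x0 => n (sa_base (smash_str S)) = pr2 Q).

Definition bmove {A B : pType} {X : Type} {x0 : X}
  (w : sigma (fun d : smash_alg A B X => sa_base d = x0)) : bcells A B x0 :=
  {| bc_pair := sa_pair (pr1 w);
     bc_push1 := fun a => sa_pushl (pr1 w) a @ pr2 w;
     bc_push0 := fun b => sa_pushr (pr1 w) b @ pr2 w;
     bc_push01 := !(ap (fun p => p @ pr2 w) (sa_pushlr (pr1 w))) |}.

Definition beval {A B : pType} {S : Smash A B} {X : Type} {x0 : X} (Q : bmaps S x0) :
  bcells A B x0 := bmove (x0 := x0) (dpair (smash_eval S (pr1 Q)) (pr2 Q)).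

Definition neval {A B : pType} {S : Smash A B} {X : Type} {x0 : X} (Q : bmaps S x0)
  (n : nmaps Q) : ncells (beval Q) :=
  let s := smash_str S in
  Build_ncells (d := beval Q)
    (fun a b => pr1 n (sa_pair s a b))
    (fun a => slide (pr1 n) (sa_pushl s a) (pr2 n))
    (fun b => slide (pr1 n) (sa_pushr s b) (pr2 n))
    (slide_nat (pr1 n) (sa_pushlr s) (pr2 n)).

Lemma isequiv_bmove (fe : Funext) {A B : pType} {X : Type} (x0 : X) :
  IsEquiv (@bmove A B X x0).
Proof.
  refine (isequiv_adjointify _ (fun d => dpair (P := fun d : smash_alg A B X => sa_base d = x0)
    (Build_smash_alg x0 (bc_pair d) (bc_push1 d) (bc_push0 d) (!(bc_push01 d))) idpath) _ _).
  - intro d.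
    refine (smash_congr fe (fun pl pr (plr : pl pt = pr pt) => Build_bcells (bc_pair d) pl pr (!plr))
      (pl := fun a => bc_push1 d a @ idpath) (pr := fun b => bc_push0 d b @ idpath)
      (plr := ap (fun p => p @ idpath) (!(bc_push01 d))) (plr' := !(bc_push01 d))
      (fun a => concat_p1 _) (fun b => concat_p1 _) _ @ _).
    + generalize (!(bc_push01 d)). generalize (bc_push0 d pt). intros p []. cbn.
      destruct (bc_push1 d pt). exact idpath.
    + assert (K : forall p (e : bc_push0 d pt = p), !(!e) = e) by (intros p []; exact idpath).
      exact (ap (Build_bcells (bc_pair d) (bc_push1 d) (bc_push0 d)) (K _ (bc_push01 d))).
  - intros [d r]. destruct r. cbn.
    refine (smash_congr fe (fun pl pr (plr : pl pt = pr pt) =>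
        dpair (P := fun d' : smash_alg A B X => sa_base d' = sa_base d)
          (Build_smash_alg (sa_base d) (sa_pair d) pl pr plr) idpath)
      (pl := fun a => sa_pushl d a @ idpath) (pr := fun b => sa_pushr d b @ idpath)
      (plr := !(!(ap (fun p => p @ idpath) (sa_pushlr d)))) (plr' := sa_pushlr d)
      (fun a => concat_p1 _) (fun b => concat_p1 _) _).
    generalize (sa_pushlr d). generalize (sa_pushr d pt). intros p []. cbn.
    destruct (sa_pushl d pt). exact idpath.
Defined.

Lemma isequiv_beval (fe : Funext) {A B : pType} (S : Smash A B) {X : Type} (x0 : X) :
  IsEquiv (fun Q : bmaps S x0 => beval Q).
Proof.
  exact (isequiv_compose _ _
    (isequiv_sigma_base (fun h : smash_type S -> X => smash_eval S h)
      (isequiv_smash_eval fe S X) (fun d => sa_base d = x0))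
    (isequiv_bmove fe x0)).
Defined.

Lemma nmaps_contr (fe : Funext) {A B : pType} (S : Smash A B) {X : Type} (x0 : X)
  (w : sigma (fun Q : bmaps S x0 => nmaps Q)) :
  dpair (P := fun Q : bmaps S x0 => nmaps Q)
    (dpair (P := fun h : smash_type S -> X => h (sa_base (smash_str S)) = x0)
       (fun _ => x0) idpath)
    (dpair (P := fun n : forall s : smash_type S, x0 = x0 => n _ = idpath)
       (fun _ => idpath) idpath) = w.
Proof.
  destruct w as [[h r] [n e]]. cbn in *. destruct e.
  revert h n. refine (htpy_ind_r fe _ _ _). exact idpath.
Qed.

Lemma loop_contr {X T : Type} {x : X}
  (F : forall q : x = x, idpath = q @ idpath -> T) q e : F idpath idpath = F q e.
Proof.
  assert (K : forall e' : idpath = q, e = e' @ !(concat_p1 q) -> F idpath idpath = F q e).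
  { intros e' K. refine (_ @ ap (F q) (!K)). clear e K. destruct e'. exact idpath. }
  assert (L : forall (S : Type) (u v w : S) (p : u = v) (r : v = w), p = p @ r @ !r)
    by (intros ? ? ? ? [] []; exact idpath).
  exact (K (e @ concat_p1 q) (L _ _ _ _ _ _)).
Qed.

Lemma ncells_contr (fe : Funext) {A B : pType} {X : Type} (x0 : X)
  (w : sigma (fun d : bcells A B x0 => ncells d)) :
  dpair (P := fun d : bcells A B x0 => ncells d)
    (Build_bcells (fun _ _ => x0) (fun _ => idpath) (fun _ => idpath) idpath)
    (Build_ncells (d := Build_bcells (fun _ _ => x0) (fun _ => idpath) (fun _ => idpath) idpath)
      (fun _ _ => idpath) (fun _ => idpath) (fun _ => idpath) idpath) = w.
Proof.
  destruct w as [[pair q1 q0 q01] [n2 n12 n02 n012]]. cbn in *.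
  revert pair n2 q1 q0 q01 n12 n02 n012.
  refine (htpy_ind2_r fe _ _ _). intros q1 q0 q01 n12 n02.
  revert q01 n02. revert q1 n12. refine (htpy_ind_r fe _ _ _). intros q01 n02.
  revert q01. revert q0 n02. refine (htpy_ind_r fe _ _ _). cbn. intros q01 e.
  exact (loop_contr (fun q (e : idpath = q @ idpath) =>
    dpair (P := fun d : bcells A B x0 => ncells d)
      (Build_bcells (fun _ _ => x0) (fun _ => idpath) (fun _ => idpath) q)
      (Build_ncells (d := Build_bcells (fun _ _ => x0) (fun _ => idpath) (fun _ => idpath) q)
        (fun _ _ => idpath) (fun _ => idpath) (fun _ => idpath) e)) q01 e).
Qed.

Lemma isequiv_neval (fe : Funext) {A B : pType} (S : Smash A B) {X : Type} {x0 : X}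
  (Q : bmaps S x0) : IsEquiv (fun n : nmaps Q => neval Q n).
Proof.
  pose (ebase := isequiv_sigma_base (fun Q : bmaps S x0 => beval Q) (isequiv_beval fe S x0)
    (fun d => ncells d)).
  refine (isequiv_contr_total (fun (Q : bmaps S x0) n => neval Q n) _ (nmaps_contr fe S x0)
    (equiv_inv ebase _) _ Q).
  intro w. exact (ap (equiv_inv ebase) (ncells_contr fe x0 _) @ eissect ebase w).
Defined.

Lemma isequiv_assoc_cells (fe : Funext) {A B C : pType} (S : Smash A B) (X : Type) :
  IsEquiv (fun d : smash_alg (pSmash S) C X => assoc_cells S d).
Proof.
  pose (P := fun x0 : X => sigma (fun Q : C -> bmaps S x0 => nmaps (Q pt))).
  pose (R := fun x0 : X => sigma (fun d : C -> bcells A B x0 => ncells (d pt))).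
  assert (e : IsEquiv (fun w : sigma P => dpair (P := R) (pr1 w)
    (dpair (P := fun d : C -> bcells A B (pr1 w) => ncells (d pt))
      (fun c => beval (pr1 (pr2 w) c)) (neval _ (pr2 (pr2 w)))))).
  { refine (isequiv_sigma_fiber (P := P) (R := R) (fun x0 w => dpair
      (P := fun d : C -> bcells A B x0 => ncells (d pt))
      (fun c => beval (pr1 w c)) (neval _ (pr2 w))) _).
    intro x0.
    exact (isequiv_sigma (P := fun Q : C -> bmaps S x0 => nmaps (Q pt))
      (R := fun d : C -> bcells A B x0 => ncells (d pt))
      (fun Q c => beval (Q c)) (isequiv_postcompose fe _ (isequiv_beval fe S x0))
      (fun Q n => neval (Q pt) n) (fun Q => isequiv_neval fe S (Q pt))). }
  pose (to := fun d : smash_alg (pSmash S) C X => dpair (P := P) (sa_base d)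
    (dpair (P := fun Q : C -> bmaps S (sa_base d) => nmaps (Q pt))
      (fun c => dpair (P := fun h : smash_type S -> X => h (sa_base (smash_str S)) = sa_base d)
         (fun x => sa_pair d x c) (sa_pushr d c))
      (dpair (P := fun n : forall s, sa_pair d s pt = sa_base d =>
           n (sa_base (smash_str S)) = sa_pushr d pt)
         (sa_pushl d) (sa_pushlr d)))).
  pose (ot := fun w : sigma P => Build_smash_alg (A := pSmash S) (B := C) (pr1 w)
    (fun x c => pr1 (pr1 (pr2 w) c) x) (pr1 (pr2 (pr2 w)))
    (fun c => pr2 (pr1 (pr2 w) c)) (pr2 (pr2 (pr2 w)))).
  pose (too := fun b : smash3_alg A B C X => dpair (P := R) (s3_base b)
    (dpair (P := fun d : C -> bcells A B (s3_base b) => ncells (d pt))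
      (fun c => Build_bcells (fun a b' => s3_tri b a b' c) (fun a => s3_push1 b a c)
        (fun b' => s3_push0 b b' c) (s3_push01 b c))
      (Build_ncells
        (d := Build_bcells (fun a b' => s3_tri b a b' pt) (fun a => s3_push1 b a pt)
          (fun b' => s3_push0 b b' pt) (s3_push01 b pt))
        (s3_push2 b) (s3_push12 b) (s3_push02 b) (s3_push012 b)))).
  pose (oto := fun w : sigma R => Build_smash3_alg (pr1 w)
    (fun a b c => bc_pair (pr1 (pr2 w) c) a b)
    (fun b c => bc_push0 (pr1 (pr2 w) c) b)
    (fun a c => bc_push1 (pr1 (pr2 w) c) a)
    (nc_push2 (pr2 (pr2 w))) (nc_push12 (pr2 (pr2 w))) (nc_push02 (pr2 (pr2 w)))
    (fun c => bc_push01 (pr1 (pr2 w) c)) (nc_push012 (pr2 (pr2 w)))).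
  refine (isequiv_adjointify _ (fun b => ot (equiv_inv e (too b))) _ _).
  - intro b. exact (ap oto (eisretr e (too b))).
  - intro d. exact (ap ot (eissect e (to d))).
Defined.

Definition from_smash3 {A B C : pType} (S : Smash A B) (S2 : Smash (pSmash S) C) (T : Smash3 A B C) :
  smash3_type T -> smash_type S2 := smash3_rec T (assoc_cells S (smash_str S2)).

(* The map (A /\ B) /\ C -> /\(A,B,C) that sends the iterated constructors of (A /\ B) /\ C,
   as listed by [assoc_cells], to the constructors of /\(A,B,C): see [to_smash3_cells]. *)
Definition to_smash3 (fe : Funext) {A B C : pType} (S : Smash A B) (S2 : Smash (pSmash S) C)
  (T : Smash3 A B C) : smash_type S2 -> smash3_type T :=
  smash_rec S2 (equiv_inv (isequiv_assoc_cells fe S (smash3_type T)) (smash3_str T)).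

Lemma to_smash3_cells (fe : Funext) {A B C : pType} (S : Smash A B) (S2 : Smash (pSmash S) C)
  (T : Smash3 A B C) : assoc_cells S (smash_eval S2 (to_smash3 fe S S2 T)) = smash3_str T.
Proof.
  exact (ap (assoc_cells S) (smash_rec_beta fe S2 _)
    @ eisretr (isequiv_assoc_cells fe S (smash3_type T)) (smash3_str T)).
Qed.

Lemma nat_push {W X Y : Type} (h : X -> Y) (q : W -> X) {s s0 : W} (p : s = s0) {x0 : X}
  (r : q s0 = x0) : ap h (ap q p @ r) = ap (fun x => h (q x)) p @ ap h r.
Proof. destruct p. exact idpath. Defined.

Lemma nat_slide {W X Y : Type} (h : X -> Y) {q : W -> X} {x0 : X} (l : forall s, q s = x0)
  {s s0 : W} (p : s = s0) {r : q s0 = x0} (w : l s0 = r) :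
  sq (nat_push h q p r) (idpath (x := ap h (l s)))
    (ap (ap h) (slide l p w)) (slide (fun s => ap h (l s)) p (ap (ap h) w)).
Proof. destruct w, p. exact idpath. Defined.

Lemma nat_lr {W X Y : Type} (h : X -> Y) (q : W -> X) {s s0 : W} {p p' : s = s0} (e : p = p')
  {x0 : X} (r : q s0 = x0) :
  sq (nat_push h q p' r) (nat_push h q p r)
    (ap (ap h) (!(ap (fun t => t @ r) (ap (ap q) e))))
    (!(ap (fun t => t @ ap h r) (ap (ap (fun x => h (q x))) e))).
Proof. destruct e, p, r. exact idpath. Defined.

Lemma nat_slide_nat {W X Y : Type} (h : X -> Y) {q : W -> X} {x0 : X} (l : forall s, q s = x0)
  {s s0 : W} {p p' : s = s0} (e : p = p') {r : q s0 = x0} (w : l s0 = r) :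
  cube (nat_lr h q e r) (nat_slide h l p w) (nat_slide h l p' w)
    (apT h (slide_nat l e w))
    (slide_nat (fun s => ap h (l s)) e (ap (ap h) w)).
Proof. destruct w, e, p. cbn. generalize (l s). intro t. destruct t. exact idpath. Defined.

Lemma assoc_cells_map (fe : Funext) {A B C : pType} (S : Smash A B) {X Y : Type} (h : X -> Y)
  (d : smash_alg (pSmash S) C X) :
  smash3_map h (assoc_cells S d) = assoc_cells S (smash_map h d).
Proof.
  set (s := smash_str S).
  exact (smash3_congr fe
    (fun b c => nat_push h (fun x => sa_pair d x c) (sa_pushr s b) (sa_pushr d c))
    (fun a c => nat_push h (fun x => sa_pair d x c) (sa_pushl s a) (sa_pushr d c))
    (fun a b => idpath)
    (fun a => nat_slide h (sa_pushl d) (sa_pushl s a) (sa_pushlr d))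
    (fun b => nat_slide h (sa_pushl d) (sa_pushr s b) (sa_pushlr d))
    (fun c => nat_lr h (fun x => sa_pair d x c) (sa_pushlr s) (sa_pushr d c))
    (nat_slide_nat h (sa_pushl d) (sa_pushlr s) (sa_pushlr d))).
Qed.

Lemma comp1 {X Y Z : Type} (g : X -> Y) (h : Y -> Z) {x y : X} (p : x = y) :
  ap (fun x => h (g x)) p = ap h (ap g p).
Proof. destruct p. exact idpath. Defined.

Lemma comp2 {X Y Z : Type} (g : X -> Y) (h : Y -> Z) {x y : X} {p q : x = y} (e : p = q) :
  sq (comp1 g h p) (comp1 g h q) (ap (ap (fun x => h (g x))) e) (ap (ap h) (ap (ap g) e)).
Proof. destruct e, p. exact idpath. Defined.

Lemma comp3 {X Y Z : Type} (g : X -> Y) (h : Y -> Z) {x y : X} {p q r : x = y}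
  {e1 : p = q} {e2 : q = r} {e3 : p = r} (E : e3 = e1 @ e2) :
  cube (comp2 g h e1) (comp2 g h e2) (comp2 g h e3)
    (apT (fun x => h (g x)) E) (apT h (apT g E)).
Proof. revert e3 E. refine (paths_rect_r _ _ _). destruct e2, e1, p. exact idpath. Defined.

Lemma smash3_eval_from_smash3 (fe : Funext) {A B C : pType} (S : Smash A B) (S2 : Smash (pSmash S) C)
  (T : Smash3 A B C) {Y : Type} (h : smash_type S2 -> Y) :
  smash3_eval T (fun x => h (from_smash3 S S2 T x)) = assoc_cells S (smash_eval S2 h).
Proof.
  refine (_ @ (ap (smash3_map h) (smash3_rec_beta fe T (assoc_cells S (smash_str S2)))
    @ assoc_cells_map fe S h (smash_str S2))).
  set (g := from_smash3 S S2 T). set (s := smash3_str T).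
  exact (smash3_congr fe
    (fun b c => comp1 g h (s3_push0 s b c))
    (fun a c => comp1 g h (s3_push1 s a c))
    (fun a b => comp1 g h (s3_push2 s a b))
    (fun a => comp2 g h (s3_push12 s a))
    (fun b => comp2 g h (s3_push02 s b))
    (fun c => comp2 g h (s3_push01 s c))
    (comp3 g h (s3_push012 s))).
Qed.

Lemma id1 {X : Type} {x y : X} (p : x = y) : ap (fun x => x) p = p.
Proof. destruct p. exact idpath. Defined.

Lemma id2 {X : Type} {x y : X} {p q : x = y} (e : p = q) :
  sq (id1 p) (id1 q) (ap (ap (fun x => x)) e) e.
Proof. destruct e, p. exact idpath. Defined.

Lemma id3 {X : Type} {x y : X} {p q r : x = y} {e1 : p = q} {e2 : q = r} {e3 : p = r}
  (E : e3 = e1 @ e2) : cube (id2 e1) (id2 e2) (id2 e3) (apT (fun x => x) E) E.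
Proof. revert e3 E. refine (paths_rect_r _ _ _). destruct e2, e1, p. exact idpath. Defined.

Lemma smash3_map_id (fe : Funext) {A B C : pType} {X : Type} (d : smash3_alg A B C X) :
  smash3_map (fun x => x) d = d.
Proof.
  exact (smash3_congr fe
    (fun b c => id1 (s3_push0 d b c))
    (fun a c => id1 (s3_push1 d a c))
    (fun a b => id1 (s3_push2 d a b))
    (fun a => id2 (s3_push12 d a))
    (fun b => id2 (s3_push02 d b))
    (fun c => id2 (s3_push01 d c))
    (id3 (s3_push012 d))).
Qed.

Lemma to_smash3_from_smash3 (fe : Funext) {A B C : pType} (S : Smash A B) (S2 : Smash (pSmash S) C)
  (T : Smash3 A B C) : forall x, to_smash3 fe S S2 T (from_smash3 S S2 T x) = x.
Proof.
  apply (smash3_uniq T (fun x => to_smash3 fe S S2 T (from_smash3 S S2 T x)) (fun x => x)).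
  exact (smash3_eval_from_smash3 fe S S2 T (to_smash3 fe S S2 T)
    @ (to_smash3_cells fe S S2 T @ !(smash3_map_id fe (smash3_str T)))).
Qed.

Lemma from_smash3_to_smash3 (fe : Funext) {A B C : pType} (S : Smash A B) (S2 : Smash (pSmash S) C)
  (T : Smash3 A B C) : forall x, from_smash3 S S2 T (to_smash3 fe S S2 T x) = x.
Proof.
  set (g := from_smash3 S S2 T). set (f := to_smash3 fe S S2 T).
  assert (e : assoc_cells S (smash_eval S2 (fun x => g (f x)))
              = assoc_cells S (smash_eval S2 (fun x => x))).
  { refine (!(smash3_eval_from_smash3 fe S S2 T (fun x => g (f x)))
      @ (_ @ smash3_eval_from_smash3 fe S S2 T (fun x => x))).
    exact (ap (fun k => smash3_eval T (fun x => g (k x))) (funext fe (to_smash3_from_smash3 fe S S2 T))). }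
  pose (ea := isequiv_assoc_cells fe S (C := C) (smash_type S2)).
  exact (smash_uniq S2 _ _ (!(eissect ea _) @ ap (equiv_inv ea) e @ eissect ea _)).
Qed.

Definition isequiv_to_smash3 (fe : Funext) {A B C : pType} (S : Smash A B)
  (S2 : Smash (pSmash S) C) (T : Smash3 A B C) : IsEquiv (to_smash3 fe S S2 T) :=
  isequiv_adjointify (to_smash3 fe S S2 T) (from_smash3 S S2 T)
    (to_smash3_from_smash3 fe S S2 T) (from_smash3_to_smash3 fe S S2 T).

Definition pSmash3 {A B C : pType} (T : Smash3 A B C) : pType :=
  {| pcarrier := smash3_type T; pt := s3_base (smash3_str T) |}.

Definition pid (A : pType) : pMap A A := Build_pMap (fun a => a) idpath.

Definition pcompose {A B C : pType} (g : pMap B C) (f : pMap A B) : pMap A C :=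
  Build_pMap (fun a => g (f a)) (ap g (point_eq f) @ point_eq g).

(* In all the pointed maps below, the pointing path is the computation rule at the base point,
   which would be [idpath] if that rule were definitional. *)
Definition to_smash3_pmap (fe : Funext) {A B C : pType} (S : Smash A B) (S2 : Smash (pSmash S) C)
  (T : Smash3 A B C) : pMap (pSmash S2) (pSmash3 T) :=
  Build_pMap (A := pSmash S2) (B := pSmash3 T) (to_smash3 fe S S2 T) (smash_rec_base S2 _).

Definition to_smash3_pinv (fe : Funext) {A B C : pType} (S : Smash A B) (S2 : Smash (pSmash S) C)
  (T : Smash3 A B C) : pMap (pSmash3 T) (pSmash S2) :=
  Build_pMap (A := pSmash3 T) (B := pSmash S2) (equiv_inv (isequiv_to_smash3 fe S S2 T))
    (smash3_rec_base T _).

Definition rotate_tri {X : Type} {x y : X} {p q r : x = y} {e1 : p = q} {e2 : q = r}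
  {e3 : p = r} (E : e3 = e1 @ e2) : !e2 = !e3 @ e1.
Proof. revert e3 E. refine (paths_rect_r _ _ _). destruct e2, e1. exact idpath. Defined.

(* <a,b,c> |-> <b,c,a>; the inverses come from the fixed orientations of the 2-path constructors. *)
Definition rotate_alg {A B C : pType} {X : Type} (d : smash3_alg B C A X) : smash3_alg A B C X := {|
  s3_base := s3_base d;
  s3_tri := fun a b c => s3_tri d b c a;
  s3_push0 := fun b c => s3_push2 d b c;
  s3_push1 := fun a c => s3_push0 d c a;
  s3_push2 := fun a b => s3_push1 d b a;
  s3_push12 := fun a => s3_push01 d a;
  s3_push02 := fun b => !(s3_push12 d b);
  s3_push01 := fun c => !(s3_push02 d c);
  s3_push012 := rotate_tri (s3_push012 d) |}.

Definition rotate {A B C : pType} (T : Smash3 A B C) (T' : Smash3 B C A) :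
  pMap (pSmash3 T) (pSmash3 T') :=
  Build_pMap (A := pSmash3 T) (B := pSmash3 T') (smash3_rec T (rotate_alg (smash3_str T')))
    (smash3_rec_base T _).

Definition swap {A B : pType} (S : Smash A B) (S' : Smash B A) : pMap (pSmash S) (pSmash S') :=
  let s := smash_str S' in
  Build_pMap (A := pSmash S) (B := pSmash S')
    (smash_rec S {|
       sa_base := sa_base s;
       sa_pair := fun a b => sa_pair s b a;
       sa_pushl := fun a => sa_pushr s a;
       sa_pushr := fun b => sa_pushl s b;
       sa_pushlr := !(sa_pushlr s) |})
    (smash_rec_base S _).

Definition push_interchange {C D : pType} {X : Type} (s : smash_alg C D X)
  {c : C} (p : c = pt) {d : D} (q : d = pt) :
  ap (fun y => sa_pair s c y) q @ sa_pushl s c = ap (fun x => sa_pair s x d) p @ sa_pushr s d.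
Proof.
  revert c p. refine (paths_rect_r _ _ _). revert d q. refine (paths_rect_r _ _ _).
  exact (sa_pushlr s).
Defined.

Definition smash_functor {A B C D : pType} (S : Smash A B) (S' : Smash C D)
  (f : pMap A C) (g : pMap B D) : pMap (pSmash S) (pSmash S') :=
  let s := smash_str S' in
  Build_pMap (A := pSmash S) (B := pSmash S')
    (smash_rec S {|
       sa_base := sa_base s;
       sa_pair := fun a b => sa_pair s (f a) (g b);
       sa_pushl := fun a => ap (fun d => sa_pair s (f a) d) (point_eq g) @ sa_pushl s (f a);
       sa_pushr := fun b => ap (fun c => sa_pair s c (g b)) (point_eq f) @ sa_pushr s (g b);
       sa_pushlr := push_interchange s (point_eq f) (point_eq g) |})
    (smash_rec_base S _).

Definition wedge (S : forall A B : pType, Smash A B) (A B : pType) : pType := pSmash (S A B).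

Definition wedge_map (S : forall A B : pType, Smash A B) {A B C D : pType}
  (f : pMap A C) (g : pMap B D) : pMap (wedge S A B) (wedge S C D) :=
  smash_functor (S A B) (S C D) f g.

Definition assoc (fe : Funext) (S : forall A B : pType, Smash A B)
  (T : forall A B C : pType, Smash3 A B C) (A B C : pType) :
  pMap (wedge S (wedge S A B) C) (wedge S A (wedge S B C)) :=
  pcompose (swap (S (wedge S B C) A) (S A (wedge S B C)))
    (pcompose (to_smash3_pinv fe (S B C) (S (wedge S B C) A) (T B C A))
      (pcompose (rotate (T A B C) (T B C A))
        (to_smash3_pmap fe (S A B) (S (wedge S A B) C) (T A B C)))).

Lemma assoc_pair (fe : Funext) (S : forall A B : pType, Smash A B)
  (T : forall A B C : pType, Smash3 A B C) (A B C : pType) (a : A) (b : B) (c : C) :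
  assoc fe S T A B C (sa_pair (smash_str (S (wedge S A B) C)) (sa_pair (smash_str (S A B)) a b) c)
  = sa_pair (smash_str (S A (wedge S B C))) a (sa_pair (smash_str (S B C)) b c).
Proof.
  pose (S2 := S (wedge S A B) C). pose (S2' := S (wedge S B C) A).
  pose (v := swap S2' (S A (wedge S B C))).
  pose (g := from_smash3 (S B C) S2' (T B C A)).
  pose (r := rotate (T A B C) (T B C A)).
  refine (ap (fun x => v (g (r x)))
    (ap (fun d => s3_tri d a b c) (to_smash3_cells fe (S A B) S2 (T A B C))) @ _).
  refine (ap (fun x => v (g x)) (ap (fun d => s3_tri d a b c)
    (smash3_rec_beta fe (T A B C) (rotate_alg (smash3_str (T B C A))))) @ _).
  refine (ap (fun x => v x) (ap (fun d => s3_tri d b c a)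
    (smash3_rec_beta fe (T B C A) (assoc_cells (S B C) (smash_str S2')))) @ _).
  exact (ap (fun d : smash_alg (wedge S B C) A _ =>
    sa_pair d (sa_pair (smash_str (S B C)) b c) a) (smash_rec_beta fe S2' _)).
Qed.

(* Main.v *)
(* Attaching, to the product of n pointed types, cones over the n coordinate hyperplanes with a
   common vertex gives a space that maps to the n-fold smash product and misses only its cells of
   dimension at least 2. Restriction of pointed maps to this space has a left inverse for every
   target: the missing coherences can always be supplied by modifying the given paths, since any
   defect of coherence on an intersection of hyperplanes extends along a projection. Hence two
   pointed maps out of ((A /\ B) /\ C) /\ D are equal as soon as they agree on the points
   <<<a,b>,c>,d> and on four families of paths, and the associators are easily seen to carry these
   cells to the corresponding cells of the other four bracketings. *)
Require Import Defs.

(** * Maps with null-homotopies on hyperplanes *)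

(* A map Q -> X with a null-homotopy on each of the hyperplanes i : R -> Q. Pointed maps transport
   [cells i T] to [cells i X] by [push], so an element of [cells i T] also plays the role of a map
   to T from Q with cones attached. *)
Definition cells {Q R : Type} (i : R -> Q) (X : pType) : Type :=
  sigma (fun h : Q -> X => forall r, h (i r) = pt).

Lemma cells_ext (fe : Funext) {Q R : Type} {i : R -> Q} {X : pType} {u v : cells i X}
  (H : forall q, pr1 u q = pr1 v q) (K : forall r, pr2 u r = H (i r) @ pr2 v r) : u = v.
Proof.
  destruct u as [h k], v as [h' k']. cbn in *.
  revert k' K.
  refine (htpy_ind fe h (fun h' H => forall k' : forall r, h' (i r) = pt,
    (forall r, k r = H (i r) @ k' r) -> dpair h k = dpair h' k') _ h' H).
  intros k' K. exact (ap (fun k => dpair h k) (funext fe K)).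
Qed.

Definition cells_fst {Q R : Type} {i : R -> Q} {X : pType} {u v : cells i X} (e : u = v) (q : Q) :
  pr1 u q = pr1 v q := ap (fun w : cells i X => pr1 w q) e.

Definition cells_snd {Q R : Type} {i : R -> Q} {X : pType} {u v : cells i X} (e : u = v) (r : R) :
  pr2 u r = cells_fst e (i r) @ pr2 v r.
Proof. destruct e. exact idpath. Defined.

Definition push {Q R : Type} {i : R -> Q} {T X : pType} (f : pMap T X) (t : cells i T) :
  cells i X :=
  dpair (P := fun h : Q -> X => forall r, h (i r) = pt)
    (fun q => f (pr1 t q)) (fun r => ap f (pr2 t r) @ point_eq f).

Lemma concat_assoc {X : Type} {x y z w : X} (p : x = y) (q : y = z) (r : z = w) :
  (p @ q) @ r = p @ (q @ r).
Proof. destruct p. exact idpath. Defined.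

Lemma push_pcompose (fe : Funext) {Q R : Type} {i : R -> Q} {T X Y : pType} (g : pMap X Y)
  (f : pMap T X) (t : cells i T) : push (pcompose g f) t = push g (push f t).
Proof.
  refine (cells_ext fe (u := push (pcompose g f) t) (v := push g (push f t))
    (fun q => idpath) (fun r => _)). cbn.
  refine (ap (fun p => p @ _) (comp1 f g _) @ _).
  refine (!(concat_assoc _ _ _) @ _).
  exact (ap (fun p => p @ point_eq g) (!(ap_pp g _ _))).
Qed.

(** * Currying of pointed maps out of a smash product *)

Definition pconst (T X : pType) : pMap T X := Build_pMap (fun _ => pt) idpath.

(** A pointed homotopy from [f] to the constant map: on the slice at [pt], this is the data that
    [sa_pushl] and [sa_pushlr] provide. *)
Definition pnull {T X : pType} (f : pMap T X) : Type :=
  sigma (fun H : forall x, f x = pt => H pt = point_eq f).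

Definition null_of_path {T X : pType} {f : pMap T X} (e : f = pconst T X) : pnull f :=
  paths_rect_r (pconst T X) (fun f _ => pnull f)
    (dpair (P := fun H : forall x : T, pt = pt :> X => H pt = idpath) (fun _ => idpath) idpath) f e.

(** Both total spaces over [f] are contractible, one as a based path space, the other by function
    extensionality, so the fibrewise map is an equivalence. *)
Lemma isequiv_null_of_path (fe : Funext) {T X : pType} (f : pMap T X) :
  IsEquiv (fun e : f = pconst T X => null_of_path e).
Proof.
  refine (isequiv_contr_total (P := fun f => f = pconst T X) (R := pnull)
    (fun f e => null_of_path e) (dpair (P := fun f => f = pconst T X) (pconst T X) idpath) _
    (dpair (P := pnull) (pconst T X) (null_of_path idpath)) _ f).
  - intros [g e]. revert g e. refine (paths_rect_r _ _ _). exact idpath.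
  - intros [[g p] [H K]]. cbn in *. destruct K.
    revert g H. refine (htpy_ind_r fe _ _ _). exact idpath.
Qed.

Definition based_eval {A B : pType} (S : Smash A B) {X : pType} (f : pMap (pSmash S) X) :
  sigma (fun d : smash_alg A B X => sa_base d = pt) :=
  dpair (P := fun d : smash_alg A B X => sa_base d = pt) (smash_eval S f) (point_eq f).

Lemma isequiv_based_eval (fe : Funext) {A B : pType} (S : Smash A B) (X : pType) :
  IsEquiv (fun f : pMap (pSmash S) X => based_eval S f).
Proof.
  pose (e := isequiv_sigma_base (fun h : smash_type S -> X => smash_eval S h)
    (isequiv_smash_eval fe S X) (fun d => sa_base d = pt)).
  refine (isequiv_compose (fun f : pMap (pSmash S) X =>
    dpair (P := fun h : smash_type S -> X => h (sa_base (smash_str S)) = pt) (pfun f) (point_eq f))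
    _ _ e).
  refine (isequiv_adjointify _ (fun w => Build_pMap (A := pSmash S) (pr1 w) (pr2 w)) _ _);
    intros; exact idpath.
Defined.

(** The other side of the smash-hom adjunction. The pointing datum is a path rather than a [pnull],
    which allows path induction on it. *)
Definition curried (T C X : pType) : Type :=
  sigma (fun D : C -> pMap T X => D pt = pconst T X).

Definition uncurry_alg {T C X : pType} (D : C -> pMap T X) (n : pnull (D pt)) :
  sigma (fun d : smash_alg T C X => sa_base d = pt) :=
  dpair (P := fun d : smash_alg T C X => sa_base d = pt)
    (Build_smash_alg pt (fun x c => D c x) (pr1 n) (fun c => point_eq (D c)) (pr2 n)) idpath.

Definition uncurry (fe : Funext) {T C X : pType} (S : Smash T C) (w : curried T C X) :
  pMap (pSmash S) X :=
  equiv_inv (isequiv_based_eval fe S X) (uncurry_alg (pr1 w) (null_of_path (pr2 w))).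

Definition slice {T C X : pType} {S : Smash T C} (f : pMap (pSmash S) X) (c : C) : pMap T X :=
  let s := smash_str S in
  Build_pMap (fun x => f (sa_pair s x c)) (ap f (sa_pushr s c) @ point_eq f).

Definition slice_null {T C X : pType} {S : Smash T C} (f : pMap (pSmash S) X) :
  pnull (slice f pt) :=
  let s := smash_str S in
  dpair (P := fun H : forall x, slice f pt x = pt => H pt = point_eq (slice f pt))
    (fun x => ap f (sa_pushl s x) @ point_eq f)
    (ap (fun p => p @ point_eq f) (ap (ap f) (sa_pushlr s))).

Definition curry (fe : Funext) {T C X : pType} {S : Smash T C} (f : pMap (pSmash S) X) :
  curried T C X :=
  dpair (P := fun D : C -> pMap T X => D pt = pconst T X) (slice f)
    (equiv_inv (isequiv_null_of_path fe (slice f pt)) (slice_null f)).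

Lemma ap_unit_right {X Y : Type} (f : X -> Y) {x y : X} {p q : x = y} (e : p = q) :
  sq (concat_p1 (ap f p)) (concat_p1 (ap f q)) (ap (fun r => r @ idpath) (ap (ap f) e))
    (ap (ap f) e).
Proof. destruct e, p. exact idpath. Defined.

Lemma uncurry_curry (fe : Funext) {T C X : pType} (S : Smash T C) (f : pMap (pSmash S) X) :
  uncurry fe S (curry fe f) = f.
Proof.
  refine (ap (fun n => equiv_inv (isequiv_based_eval fe S X) (uncurry_alg (slice f) n))
    (eisretr (isequiv_null_of_path fe (slice f pt)) (slice_null f)) @ _).
  refine (ap (equiv_inv (isequiv_based_eval fe S X)) (_ : _ = based_eval S f)
    @ eissect (isequiv_based_eval fe S X) f).
  (* Once [point_eq f] is contracted, the two tuples differ only by trailing composites with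
     [idpath]. *)
  destruct X as [X x0], f as [f p]. cbn in f, p. destruct p.
  unfold uncurry_alg, based_eval, slice, slice_null. cbn.
  set (s := smash_str S).
  refine (smash_congr fe (fun pl pr (plr : pl pt = pr pt) =>
      dpair (P := fun d => sa_base d = f (sa_base s))
        (Build_smash_alg (f (sa_base s)) (fun x c => f (sa_pair s x c)) pl pr plr) idpath)
    (fun x => concat_p1 (ap f (sa_pushl s x))) (fun c => concat_p1 (ap f (sa_pushr s c))) _).
  exact (ap_unit_right f (sa_pushlr s)).
Qed.

(** * Detection of pointed maps by their cells *)

(** A retraction is carried along rather than mere injectivity, because the inductive step applies
    [N] to corrected cells, which need not be restrictions of a map. *)
Definition detects {Q R : Type} {i : R -> Q} {T : pType} (t : cells i T) (X : pType) : Type :=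
  sigma (fun N : cells i X -> pMap T X => forall f, N (push f t) = f).

Definition point_cells (A : pType) : cells (fun _ : unit => pt : A) A :=
  dpair (P := fun h : A -> A => forall r : unit, h pt = pt) (fun a => a) (fun _ => idpath).

Definition point_detects (A X : pType) : detects (point_cells A) X :=
  dpair (P := fun N : _ -> pMap A X => forall f, N (push f (point_cells A)) = f)
    (fun u => Build_pMap (pr1 u) (pr2 u tt)) (fun f => idpath).

(** On the left are the old hyperplanes times [C], on the right the new one, where the coordinate in
    [C] is the base point. *)
Definition smash_index {Q R : Type} (i : R -> Q) (C : pType) (w : R * C + Q) : Q * C :=
  match w with inl w => (i (fst w), snd w) | inr q => (q, pt) end.

Definition smash_cells {Q R : Type} {i : R -> Q} {T C : pType} (S : Smash T C) (t : cells i T) :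
  cells (smash_index i C) (pSmash S) :=
  let s := smash_str S in
  dpair (P := fun h : Q * C -> pSmash S => forall w, h (smash_index i C w) = pt)
    (fun y => sa_pair s (pr1 t (fst y)) (snd y))
    (fun w => match w with
      | inl w => ap (fun x => sa_pair s x (snd w)) (pr2 t (fst w)) @ sa_pushr s (snd w)
      | inr q => sa_pushl s (pr1 t q)
      end).

Lemma ap_const {X Y : Type} (y : Y) {a b : X} (p : a = b) : ap (fun _ => y) p = idpath.
Proof. destruct p. exact idpath. Defined.

Lemma cancel_null {X : Type} {a y : X} (u v : a = y) {z : y = y} (e : z = idpath) :
  u @ !u @ v = v @ z.
Proof. revert z e. refine (paths_rect_r _ _ _). destruct u. exact (!(concat_p1 v)). Defined.

Lemma cancel_const {X : Type} {a y : X} (w : a = y) {z : y = y} (e : z = idpath) :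
  w @ !z @ idpath = w.
Proof. revert z e. refine (paths_rect_r _ _ _). destruct w. exact idpath. Defined.

(** The two cancellations underlie [correction_null] and [correction_trivial]; their agreement is
    what [correction_coherence] comes down to. *)
Lemma cancel_null_const {X : Type} {y : X} {z : y = y} (e : z = idpath) :
  cancel_null z idpath e = cancel_const z e.
Proof. revert z e. refine (paths_rect_r _ _ _). exact idpath. Qed.

Section Step.
Context (fe : Funext) {Q R : Type} {i : R -> Q} {T C X : pType} (t : cells i T).

Definition const_cells (r : R) : pr2 (push (pconst T X) t) r = idpath :=
  ap (fun p => p @ idpath) (ap_const pt (pr2 t r)).

(* The paths over R * C are modified so as to agree, at [pt : C], with those over Q. *)
Definition corrected (u : cells (smash_index i C) X) (c : C) : cells i X :=
  dpair (P := fun h : Q -> X => forall r, h (i r) = pt) (fun q => pr1 u (q, c))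
    (fun r => pr2 u (inl (r, c)) @ !(pr2 u (inl (r, pt))) @ pr2 u (inr (i r))).

Definition corrected_null (u : cells (smash_index i C) X) :
  corrected u pt = push (pconst T X) t :=
  cells_ext fe (u := corrected u pt) (v := push (pconst T X) t) (fun q => pr2 u (inr q))
    (fun r => cancel_null _ _ (const_cells r)).

Definition curried_cells (w : curried T C X) : cells (smash_index i C) X :=
  dpair (P := fun h : Q * C -> X => forall w, h (smash_index i C w) = pt)
    (fun y => pr1 w (snd y) (pr1 t (fst y)))
    (fun x => match x with
      | inl x => pr2 (push (pr1 w (snd x)) t) (fst x)
      | inr q => pr1 (null_of_path (pr2 w)) (pr1 t q)
      end).

(** This is [corrected] on [curried_cells w], with the slice [f] at the base point, its null path
    [e] and a general slice [g] made independent, so that induction on [e] is available. *)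
Definition correction (f : pMap T X) (e : f = pconst T X) (g : pMap T X) : cells i X :=
  dpair (P := fun h : Q -> X => forall r, h (i r) = pt) (pr1 (push g t))
    (fun r => pr2 (push g t) r @ !(pr2 (push f t) r) @ pr1 (null_of_path e) (pr1 t (i r))).

Definition correction_null (f : pMap T X) (e : f = pconst T X) :
  correction f e f = push (pconst T X) t :=
  cells_ext fe (u := correction f e f) (v := push (pconst T X) t)
    (fun q => pr1 (null_of_path e) (pr1 t q)) (fun r => cancel_null _ _ (const_cells r)).

Definition correction_trivial (g : pMap T X) : forall f e, correction f e g = push g t :=
  paths_rect_r (pconst T X) (fun f e => correction f e g = push g t)
    (cells_ext fe (u := correction _ idpath g) (v := push g t)
      (fun q => idpath) (fun r => cancel_const _ (const_cells r))).

(** Compatibility with the null paths, as [curried_ext] requires. After induction on [e], the two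
    sides differ only in the choice of cancellation. *)
Lemma correction_coherence (N : cells i X -> pMap T X) (retr : forall f, N (push f t) = f) f e :
  ap N (correction_null f e) @ retr (pconst T X)
  = (ap N (correction_trivial f f e) @ retr f) @ e.
Proof.
  revert f e. refine (paths_rect_r _ _ _).
  refine (_ @ !(concat_p1 _)). refine (ap (fun p => ap N p @ retr (pconst T X)) _).
  refine (ap (cells_ext fe (u := correction _ idpath (pconst T X)) (v := push (pconst T X) t)
    (fun q => idpath)) (funext fe (fun r => cancel_null_const (const_cells r)))).
Qed.

Lemma curried_ext (w w' : curried T C X) (H : forall c, pr1 w c = pr1 w' c)
  (K : pr2 w = H pt @ pr2 w') : w = w'.
Proof.
  destruct w as [D e], w' as [D' e']. cbn in *. revert e' K.
  refine (htpy_ind fe D (fun D' H => forall e' : D' pt = pconst T X,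
    e = H pt @ e' -> dpair D e = dpair D' e') _ D' H).
  intros e' K. exact (ap (fun e => dpair D e) K).
Qed.

(** The left inverse corrects the cells, applies [N] slice by slice and uncurries. On the
    restriction of a map the correction is trivial, and [retr] recovers each slice. *)
Definition smash_detects (S : Smash T C) (d : detects t X) : detects (smash_cells S t) X.
Proof.
  destruct d as [N retr].
  pose (N' := fun u : cells (smash_index i C) X =>
    dpair (P := fun D : C -> pMap T X => D pt = pconst T X) (fun c => N (corrected u c))
      (ap N (corrected_null u) @ retr (pconst T X))).
  refine (dpair (P := fun N : _ -> pMap (pSmash S) X => forall f, N (push f (smash_cells S t)) = f)
    (fun u => uncurry fe S (N' u)) _).
  intro f.
  assert (E : push f (smash_cells S t) = curried_cells (curry fe f)).
  { refine (cells_ext fe (u := push f (smash_cells S t)) (v := curried_cells (curry fe f))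
      (fun q => idpath) _).
    intros [[r c] | q]; cbn.
    - refine (ap (fun p => p @ _) (ap_pp f _ _) @ _).
      refine (concat_assoc _ _ _ @ _).
      exact (ap (fun p => p @ _) (!(comp1 (fun x => sa_pair (smash_str S) x c) f _))).
    - exact (!(ap (fun n => pr1 n (pr1 t q))
        (eisretr (isequiv_null_of_path fe (slice f pt)) (slice_null f)))). }
  refine (ap (fun u => uncurry fe S (N' u)) E @ _).
  refine (ap (uncurry fe S) (_ : _ = curry fe f) @ uncurry_curry fe S f).
  generalize (curry fe f). clear f E. intro w.
  (* On [curried_cells w], [corrected] computes to [correction] and [corrected_null] to
     [correction_null]. *)
  refine (curried_ext (N' (curried_cells w)) w
    (fun c => ap N (correction_trivial (pr1 w c) _ (pr2 w)) @ retr (pr1 w c)) _).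
  exact (correction_coherence N retr (pr1 w pt) (pr2 w)).
Qed.
End Step.

(** * Base points in the computation rules of the associator *)

Lemma ap_conj {X Y : Type} (f : X -> Y) {a b c d : X} (p : b = a) (q : b = c) (r : c = d)
  {p' : f b = f a} {q' : f b = f c} {r' : f c = f d} (hp : ap f p = p') (hq : ap f q = q')
  (hr : ap f r = r') : ap f (!p @ (q @ r)) = !p' @ (q' @ r').
Proof. destruct hp, hq, hr, r, q, p. exact idpath. Qed.

Lemma ap_pr1_fiber {X : Type} {P : X -> Type} {x : X} {u v : P x} (p : u = v) :
  ap (fun w : sigma P => pr1 w) (ap (fun u => dpair x u) p) = idpath.
Proof. destruct p. exact idpath. Qed.

Lemma ap_pr1_map_fiber {X : Type} {P R : X -> Type} (g : forall x, P x -> R x) {x : X} {u v : P x}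
  (p : u = v) :
  ap (fun w : sigma R => pr1 w)
    (ap (fun w : sigma P => dpair (P := R) (pr1 w) (g _ (pr2 w))) (ap (fun u => dpair x u) p))
  = idpath.
Proof. destruct p. exact idpath. Qed.

Lemma sigma_fiber_retr_base {X : Type} {P R : X -> Type} (g : forall x, P x -> R x)
  (eg : forall x, IsEquiv (g x)) (w : sigma R) :
  ap (fun w : sigma R => pr1 w) (eisretr (isequiv_sigma_fiber g eg) w) = idpath.
Proof.
  unfold isequiv_sigma_fiber. cbn [eisretr isequiv_adjointify].
  refine (ap_conj (fun w : sigma R => pr1 w) _ _ _ _ _ _ @ _).
  - apply ap_pr1_fiber.
  - apply ap_pr1_map_fiber.
  - apply ap_pr1_fiber.
  - exact idpath.
Qed.

Lemma sigma_fiber_sect_base {X : Type} {P R : X -> Type} (g : forall x, P x -> R x)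
  (eg : forall x, IsEquiv (g x)) (w : sigma P) :
  ap (fun w : sigma P => pr1 w) (eissect (isequiv_sigma_fiber g eg) w) = idpath.
Proof. exact (ap_pr1_fiber _). Qed.

(** [isequiv_assoc_cells] is built fibrewise over the value at the base point, so its retraction
    homotopy is trivial there. This controls the pointing path of [to_smash3_pmap]. *)
Lemma assoc_cells_retr_base (fe : Funext) {A B C : pType} (S : Smash A B) {X : Type}
  (b : smash3_alg A B C X) :
  ap (fun d => s3_base d) (eisretr (isequiv_assoc_cells fe S X) b) = idpath.
Proof.
  unfold isequiv_assoc_cells. cbn [eisretr isequiv_adjointify].
  refine (ap_conj (fun d => s3_base d) _ _ _ _ _ _ @ _).
  (* After the repackaging of nested pairs as a tuple, [s3_base] becomes [pr1]. *)
  - lazymatch goal with |- ap ?f (ap ?g ?p) = _ => refine (!(comp1 g f p) @ _) end.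
    exact (sigma_fiber_retr_base _ _ _).
  - lazymatch goal with |- ap ?f (ap ?g (ap ?h ?p)) = _ =>
      refine (ap (ap f) (!(comp1 h g p)) @ (!(comp1 (fun x => g (h x)) f p) @ _)) end.
    exact (sigma_fiber_sect_base _ _ _).
  - lazymatch goal with |- ap ?f (ap ?g ?p) = _ => refine (!(comp1 g f p) @ _) end.
    exact (sigma_fiber_retr_base _ _ _).
  - exact idpath.
Qed.

(** * Recursion maps on cells *)

(** Cone paths of iterated smash products are an inner path [m] followed by an outer push;
    naturality of [H] along [m] carries the rule at its end back to its start. *)
Lemma push_slide {W X : pType} (f : pMap W X) {Z : Type} {q : Z -> W} {q' : Z -> X}
  (H : forall z, f (q z) = q' z) {z z0 : Z} (m : z = z0) {r : q z0 = pt} {r' : q' z0 = pt}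
  (K : ap f r @ point_eq f = H z0 @ r') :
  ap f (ap q m @ r) @ point_eq f = H z @ (ap q' m @ r').
Proof. destruct m. exact K. Qed.

Definition alg_cells {A B : pType} {X : Type} (d : smash_alg A B X) :
  cells (smash_index (fun _ : unit => pt : A) B) {| pcarrier := X; pt := sa_base d |} :=
  dpair (P := fun h : A * B -> {| pcarrier := X; pt := sa_base d |} =>
      forall w, h (smash_index (fun _ : unit => pt : A) B w) = pt)
    (fun y => sa_pair d (fst y) (snd y))
    (fun w => match w with inl w => sa_pushr d (snd w) | inr a => sa_pushl d a end).

Definition index3 (A B C : pType) :=
  smash_index (smash_index (fun _ : unit => pt : A) B) C.

Definition alg3_cells {A B C : pType} {X : Type} (d : smash3_alg A B C X) :
  cells (index3 A B C)
    {| pcarrier := X; pt := s3_base d |} :=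
  dpair (P := fun h : A * B * C -> {| pcarrier := X; pt := s3_base d |} =>
      forall w, h (index3 A B C w) = pt)
    (fun y => s3_tri d (fst (fst y)) (snd (fst y)) (snd y))
    (fun w => match w with
      | inl (inl (_, b), c) => s3_push0 d b c
      | inl (inr a, c) => s3_push1 d a c
      | inr (a, b) => s3_push2 d a b
      end).

Definition smash_rec_pmap {A B : pType} (S : Smash A B) {X : Type} (d : smash_alg A B X) :
  pMap (pSmash S) {| pcarrier := X; pt := sa_base d |} :=
  Build_pMap (A := pSmash S) (B := {| pcarrier := X; pt := sa_base d |}) (smash_rec S d)
    (smash_rec_base S d).

Definition smash3_rec_pmap {A B C : pType} (T : Smash3 A B C) {X : Type}
  (d : smash3_alg A B C X) : pMap (pSmash3 T) {| pcarrier := X; pt := s3_base d |} :=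
  Build_pMap (A := pSmash3 T) (B := {| pcarrier := X; pt := s3_base d |}) (smash3_rec T d)
    (smash3_rec_base T d).

(** Extracts the rule for a path constructor from the single path [e] between dependent tuples;
    [ap v e] becomes the pointing path of the recursion map. *)
Lemma dpath1_beta {X Y D : Type} {x y : X} {p : x = y} {u v : D -> Y}
  (s : forall d, dpath1 (fun _ => Y) p (u d) (v d)) {d d' : D} (e : d = d')
  {a : u d = v d} {a' : u d' = v d'} (h : unconst1 (s d) = a) (h' : unconst1 (s d') = a') :
  a @ ap v e = ap u e @ a'.
Proof. destruct h, h', e. exact (concat_p1 _). Qed.

Lemma push_smash_rec (fe : Funext) {A B : pType} (S : Smash A B) {X : Type}
  (d : smash_alg A B X) : push (smash_rec_pmap S d) (alg_cells (smash_str S)) = alg_cells d.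
Proof.
  pose (e := smash_beta S _ (smash_const (smash_str S) d)).
  refine (cells_ext fe (u := push (smash_rec_pmap S d) (alg_cells (smash_str S)))
    (v := alg_cells d) (fun y => ap (fun k => sd_pair k (fst y) (snd y)) e) _).
  intros [[r b] | a].
  - exact (dpath1_beta (fun k => sd_pushr k b) e
      (unconst1_apd (smash_rec S d) (sa_pushr (smash_str S) b))
      (unconst1_const1 (sa_pushr (smash_str S) b) (sa_pushr d b))).
  - exact (dpath1_beta (fun k => sd_pushl k a) e
      (unconst1_apd (smash_rec S d) (sa_pushl (smash_str S) a))
      (unconst1_const1 (sa_pushl (smash_str S) a) (sa_pushl d a))).
Qed.

Lemma push_smash3_rec (fe : Funext) {A B C : pType} (T : Smash3 A B C) {X : Type}
  (d : smash3_alg A B C X) :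
  push (smash3_rec_pmap T d) (alg3_cells (smash3_str T)) = alg3_cells d.
Proof.
  pose (e := smash3_beta T _ (smash3_const (smash3_str T) d)).
  refine (cells_ext fe (u := push (smash3_rec_pmap T d) (alg3_cells (smash3_str T)))
    (v := alg3_cells d)
    (fun y => ap (fun k => s3d_tri k (fst (fst y)) (snd (fst y)) (snd y)) e) _).
  intros [[[[r b] | a] c] | [a b]].
  - exact (dpath1_beta (fun k => s3d_push0 k b c) e
      (unconst1_apd (smash3_rec T d) (s3_push0 (smash3_str T) b c))
      (unconst1_const1 (s3_push0 (smash3_str T) b c) (s3_push0 d b c))).
  - exact (dpath1_beta (fun k => s3d_push1 k a c) e
      (unconst1_apd (smash3_rec T d) (s3_push1 (smash3_str T) a c))
      (unconst1_const1 (s3_push1 (smash3_str T) a c) (s3_push1 d a c))).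
  - exact (dpath1_beta (fun k => s3d_push2 k a b) e
      (unconst1_apd (smash3_rec T d) (s3_push2 (smash3_str T) a b))
      (unconst1_const1 (s3_push2 (smash3_str T) a b) (s3_push2 d a b))).
Qed.

(** * The associator on cells *)

Definition rotate_cells {A B C X : pType}
  (u : cells (index3 B C A) X) :
  cells (index3 A B C) X :=
  dpair (P := fun h : A * B * C -> X =>
      forall w, h (index3 A B C w) = pt)
    (fun y => pr1 u (snd (fst y), snd y, fst (fst y)))
    (fun w => match w with
      | inl (inl (_, b), c) => pr2 u (inr (b, c))
      | inl (inr a, c) => pr2 u (inl (inl (tt, c), a))
      | inr (a, b) => pr2 u (inl (inr b, a))
      end).

Lemma push_rotate_cells (fe : Funext) {A B C X Y : pType} (f : pMap X Y)
  (u : cells (index3 B C A) X) :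
  push f (rotate_cells u) = rotate_cells (push f u) :> cells (index3 A B C) Y.
Proof.
  refine (cells_ext fe (u := push f (rotate_cells u)) (v := rotate_cells (push f u))
    (fun y => idpath) _).
  intros [[[[r b] | a] c] | [a b]]; exact idpath.
Qed.

Lemma push_rotate (fe : Funext) {A B C : pType} (T : Smash3 A B C) (T' : Smash3 B C A) :
  push (rotate T T') (alg3_cells (smash3_str T)) = rotate_cells (alg3_cells (smash3_str T')).
Proof.
  refine (push_smash3_rec fe T (rotate_alg (smash3_str T')) @ _).
  refine (cells_ext fe (u := alg3_cells (rotate_alg (smash3_str T')))
    (v := rotate_cells (alg3_cells (smash3_str T'))) (fun y => idpath) _).
  intros [[[[r b] | a] c] | [a b]]; exact idpath.
Qed.

Definition left_cells {A B C : pType} (S : Smash A B) (S2 : Smash (pSmash S) C) :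
  cells (index3 A B C) (pSmash S2) :=
  smash_cells S2 (smash_cells S (point_cells A)).

Lemma push_smash_rec_left (fe : Funext) {A B C : pType} (S : Smash A B) (S2 : Smash (pSmash S) C)
  {X : Type} (d : smash_alg (pSmash S) C X) :
  push (smash_rec_pmap S2 d) (left_cells S S2) = alg3_cells (assoc_cells S d).
Proof.
  pose proof (push_smash_rec fe S2 d) as e.
  refine (cells_ext fe (u := push (smash_rec_pmap S2 d) (left_cells S S2))
    (v := alg3_cells (assoc_cells S d))
    (fun y => cells_fst e (sa_pair (smash_str S) (fst (fst y)) (snd (fst y)), snd y)) _).
  intros [[[[r b] | a] c] | [a b]].
  - exact (push_slide (smash_rec_pmap S2 d) (fun x => cells_fst e (x, c)) _
      (cells_snd e (inl (tt, c)))).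
  - exact (push_slide (smash_rec_pmap S2 d) (fun x => cells_fst e (x, c)) _
      (cells_snd e (inl (tt, c)))).
  - exact (cells_snd e (inr _)).
Qed.

(** Matching on the base path lets [ap based_cells] turn a path of based tuples into a path of
    cells, with no transport between pointed types. *)
Definition based_cells {A B C : pType} {X : Type} {x0 : X}
  (w : sigma (fun d : smash3_alg A B C X => s3_base d = x0)) :
  cells (index3 A B C) {| pcarrier := X; pt := x0 |} :=
  match pr2 w in _ = x0 return cells _ {| pcarrier := X; pt := x0 |} with
  | idpath => alg3_cells (pr1 w)
  end.

Lemma based_path {X Y : Type} (f : X -> Y) {x x' : X} (e : x = x') :
  dpair (P := fun x => f x = f x') x (ap f e) = dpair x' idpath.
Proof. destruct e. exact idpath. Qed.

(** The path from [assoc_cells S d] to [t] has trivial base component, hence is a path of based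
    tuples. *)
Lemma push_to_smash3 (fe : Funext) {A B C : pType} (S : Smash A B) (S2 : Smash (pSmash S) C)
  (T : Smash3 A B C) :
  push (to_smash3_pmap fe S S2 T) (left_cells S S2) = alg3_cells (smash3_str T).
Proof.
  pose (t := smash3_str T).
  pose (d := equiv_inv (isequiv_assoc_cells fe S (C := C) (smash3_type T)) t).
  refine (push_smash_rec_left fe S S2 d @ _).
  exact (ap based_cells (!(ap (fun e => dpair (P := fun d => s3_base d = s3_base t)
      (assoc_cells S d) e) (assoc_cells_retr_base fe S t))
    @ based_path (fun d => s3_base d) (eisretr (isequiv_assoc_cells fe S _) t))).
Qed.

Lemma push_from_smash3 (fe : Funext) {A B C : pType} (S : Smash A B) (S2 : Smash (pSmash S) C)
  (T : Smash3 A B C) :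
  push (to_smash3_pinv fe S S2 T) (alg3_cells (smash3_str T)) = left_cells S S2.
Proof.
  refine (push_smash3_rec fe T (assoc_cells S (smash_str S2)) @ _).
  refine (cells_ext fe (u := alg3_cells (assoc_cells S (smash_str S2)))
    (v := left_cells S S2) (fun y => idpath) _).
  intros [[[[r b] | a] c] | [a b]]; exact idpath.
Qed.

Definition right_cells {A B C : pType} (S : Smash B C) (S2 : Smash A (pSmash S)) :
  cells (index3 A B C) (pSmash S2) :=
  let s := smash_str S in
  let s2 := smash_str S2 in
  dpair (P := fun h : A * B * C -> pSmash S2 =>
      forall w, h (index3 A B C w) = pt)
    (fun y => sa_pair s2 (fst (fst y)) (sa_pair s (snd (fst y)) (snd y)))
    (fun w => match w with
      | inl (inl (_, b), c) => sa_pushr s2 (sa_pair s b c)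
      | inl (inr a, c) => ap (fun x => sa_pair s2 a x) (sa_pushr s c) @ sa_pushl s2 a
      | inr (a, b) => ap (fun x => sa_pair s2 a x) (sa_pushl s b) @ sa_pushl s2 a
      end).

Definition swap_alg {A B : pType} (S : Smash B A) : smash_alg A B (smash_type S) :=
  let s := smash_str S in
  Build_smash_alg (sa_base s) (fun a b => sa_pair s b a) (sa_pushr s) (sa_pushl s)
    (!(sa_pushlr s)).

Lemma push_swap (fe : Funext) {A B C : pType} (S : Smash B C) (S2 : Smash (pSmash S) A)
  (S2' : Smash A (pSmash S)) :
  push (swap S2 S2') (rotate_cells (left_cells S S2)) = right_cells S S2'.
Proof.
  pose proof (push_smash_rec fe S2 (swap_alg S2')) as e.
  refine (cells_ext fe (u := push (swap S2 S2') (rotate_cells (left_cells S S2)))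
    (v := right_cells S S2')
    (fun y => cells_fst e (sa_pair (smash_str S) (snd (fst y)) (snd y), fst (fst y))) _).
  intros [[[[r b] | a] c] | [a b]].
  - exact (cells_snd e (inr _)).
  - exact (push_slide (swap S2 S2') (fun x => cells_fst e (x, a)) _
      (cells_snd e (inl (tt, a)))).
  - exact (push_slide (swap S2 S2') (fun x => cells_fst e (x, a)) _
      (cells_snd e (inl (tt, a)))).
Qed.

(** Each of the four factors carries cells to cells up to relabelling, and relabelling commutes with
    [push]. *)
Lemma push_assoc (fe : Funext) (S : forall A B : pType, Smash A B)
  (T : forall A B C : pType, Smash3 A B C) (A B C : pType) :
  push (assoc fe S T A B C) (left_cells (S A B) (S (wedge S A B) C))
  = right_cells (S B C) (S A (wedge S B C)).
Proof.
  unfold assoc.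
  refine (push_pcompose fe _ _ _ @ (ap (push _) _ @ push_swap fe (S B C) _ _)).
  refine (push_pcompose fe _ _ _ @ (ap (push _) (push_pcompose fe _ _ _) @ _)).
  refine (ap (fun u => push _ (push _ u)) (push_to_smash3 fe _ _ _) @ _).
  refine (ap (push _) (push_rotate fe _ _) @ _).
  refine (push_rotate_cells fe _ _ @ ap rotate_cells (push_from_smash3 fe _ _ _)).
Qed.

(** * Functoriality of the smash product on cells *)

Definition functor_alg {A B C D : pType} (S : Smash C D) (f : pMap A C) (g : pMap B D) :
  smash_alg A B (smash_type S) :=
  let s := smash_str S in
  Build_smash_alg (sa_base s) (fun a b => sa_pair s (f a) (g b))
    (fun a => ap (fun d => sa_pair s (f a) d) (point_eq g) @ sa_pushl s (f a))
    (fun b => ap (fun c => sa_pair s c (g b)) (point_eq f) @ sa_pushr s (g b))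
    (push_interchange s (point_eq f) (point_eq g)).

Lemma ap_push {W X Y : Type} (g : W -> X) (h : X -> Y) {w w0 : W} (m : w = w0) {x0 : X}
  (p : g w0 = x0) {y0 : Y} (r : h x0 = y0) :
  ap (fun w => h (g w)) m @ (ap h p @ r) = ap h (ap g m @ p) @ r.
Proof. destruct m. exact idpath. Qed.

Lemma push_functor_left (fe : Funext) {Q R : Type} {i : R -> Q} {W X C : pType} (S : Smash W C)
  (S' : Smash X C) (f : pMap W X) (t : cells i W) :
  push (smash_functor S S' f (pid C)) (smash_cells S t) = smash_cells S' (push f t).
Proof.
  pose proof (push_smash_rec fe S (functor_alg S' f (pid C))) as e.
  refine (cells_ext fe (u := push (smash_functor S S' f (pid C)) (smash_cells S t))
    (v := smash_cells S' (push f t)) (fun y => cells_fst e (pr1 t (fst y), snd y)) _).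
  intros [[r c] | q].
  - refine (push_slide (smash_functor S S' f (pid C)) (fun x => cells_fst e (x, c)) _
      (cells_snd e (inl (tt, c))) @ _).
    (* The inner path and the pointing path of [f] merge into one cone path of [push f t]. *)
    exact (ap (fun p => _ @ p) (ap_push f (fun x => sa_pair (smash_str S') x c) _ _ _)).
  - exact (cells_snd e (inr _)).
Qed.

Definition smash_index_right {Q R : Type} (A : pType) (i : R -> Q) (w : A * R + Q) : A * Q :=
  match w with inl w => (fst w, i (snd w)) | inr q => (pt, q) end.

Definition smash_cells_right {Q R : Type} {i : R -> Q} {A W : pType} (S : Smash A W)
  (t : cells i W) : cells (smash_index_right A i) (pSmash S) :=
  let s := smash_str S in
  dpair (P := fun h : A * Q -> pSmash S => forall w, h (smash_index_right A i w) = pt)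
    (fun y => sa_pair s (fst y) (pr1 t (snd y)))
    (fun w => match w with
      | inl w => ap (fun x => sa_pair s (fst w) x) (pr2 t (snd w)) @ sa_pushl s (fst w)
      | inr q => sa_pushr s (pr1 t q)
      end).

Lemma push_functor_right (fe : Funext) {Q R : Type} {i : R -> Q} {A W X : pType} (S : Smash A W)
  (S' : Smash A X) (f : pMap W X) (t : cells i W) :
  push (smash_functor S S' (pid A) f) (smash_cells_right S t) = smash_cells_right S' (push f t).
Proof.
  pose proof (push_smash_rec fe S (functor_alg S' (pid A) f)) as e.
  refine (cells_ext fe (u := push (smash_functor S S' (pid A) f) (smash_cells_right S t))
    (v := smash_cells_right S' (push f t)) (fun y => cells_fst e (fst y, pr1 t (snd y))) _).
  intros [[a r] | q].
  - refine (push_slide (smash_functor S S' (pid A) f) (fun x => cells_fst e (a, x)) _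
      (cells_snd e (inr a)) @ _).
    exact (ap (fun p => _ @ p) (ap_push f (fun x => sa_pair (smash_str S') a x) _ _ _)).
  - exact (cells_snd e (inl (tt, _))).
Qed.

(** * Cells of fourfold products *)

Definition index4 (A B C D : pType) :=
  smash_index (index3 A B C) D.

(** Hyperplanes are matched by the coordinate fixed at the base point; the one for [A] is outermost
    in one indexing and innermost in the other. *)
Definition reassociate_cells {A B C D X : pType}
  (u : cells (smash_index_right A (index3 B C D)) X) :
  cells (index4 A B C D) X :=
  dpair (P := fun h : A * B * C * D -> X => forall w, h (index4 A B C D w) = pt)
    (fun y => pr1 u (fst (fst (fst y)), (snd (fst (fst y)), snd (fst y), snd y)))
    (fun w => match w with
      | inl (inl (inl (_, b), c), d) => pr2 u (inr (b, c, d))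
      | inl (inl (inr a, c), d) => pr2 u (inl (a, inl (inl (tt, c), d)))
      | inl (inr (a, b), d) => pr2 u (inl (a, inl (inr b, d)))
      | inr (a, b, c) => pr2 u (inl (a, inr (b, c)))
      end).

Lemma push_reassociate_cells (fe : Funext) {A B C D X Y : pType} (f : pMap X Y)
  (u : cells (smash_index_right A (index3 B C D)) X) :
  push f (reassociate_cells u) = reassociate_cells (push f u).
Proof.
  refine (cells_ext fe (u := push f (reassociate_cells u)) (v := reassociate_cells (push f u))
    (fun y => idpath) _).
  intros [[[[[[r b] | a] c] | [a b]] d] | [[a b] c]]; exact idpath.
Qed.

Definition middle_cells {A B C D : pType} (S : Smash A B) (S' : Smash C D)
  (S2 : Smash (pSmash S) (pSmash S')) : cells (index4 A B C D) (pSmash S2) :=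
  let s := smash_str S in
  let s' := smash_str S' in
  let s2 := smash_str S2 in
  dpair (P := fun h : A * B * C * D -> pSmash S2 => forall w, h (index4 A B C D w) = pt)
    (fun y => sa_pair s2 (sa_pair s (fst (fst (fst y))) (snd (fst (fst y))))
      (sa_pair s' (snd (fst y)) (snd y)))
    (fun w => match w with
      | inl (inl (inl (_, b), c), d) =>
          ap (fun x => sa_pair s2 x (sa_pair s' c d)) (sa_pushr s b) @ sa_pushr s2 (sa_pair s' c d)
      | inl (inl (inr a, c), d) =>
          ap (fun x => sa_pair s2 x (sa_pair s' c d)) (sa_pushl s a) @ sa_pushr s2 (sa_pair s' c d)
      | inl (inr (a, b), d) =>
          ap (fun x => sa_pair s2 (sa_pair s a b) x) (sa_pushr s' d) @ sa_pushl s2 (sa_pair s a b)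
      | inr (a, b, c) =>
          ap (fun x => sa_pair s2 (sa_pair s a b) x) (sa_pushl s' c) @ sa_pushl s2 (sa_pair s a b)
      end).

Section AssocPaths.
Context {X Y Z : pType} {S : Smash X Y} {S2 : Smash (pSmash S) Z} {S' : Smash Y Z}
  {S2' : Smash X (pSmash S')} (f : pMap (pSmash S2) (pSmash S2'))
  (e : push f (left_cells S S2) = right_cells S' S2').
Let s := smash_str S.
Let s2 := smash_str S2.
Let s' := smash_str S'.
Let s2' := smash_str S2'.

(** In a fourfold product, one factor is itself a smash product and reaches its base point along an
    inner push [m]. Leaving [m] free reduces to [idpath], where the claim is a component of [e]. *)
Lemma assoc_path0 {x : X} (m : x = pt) (y : Y) (z : Z) :
  ap f (ap (fun w => sa_pair s2 w z) (ap (fun x => sa_pair s x y) m @ sa_pushr s y)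
    @ sa_pushr s2 z) @ point_eq f
  = cells_fst e (x, y, z)
    @ (ap (fun x => sa_pair s2' x (sa_pair s' y z)) m @ sa_pushr s2' (sa_pair s' y z)).
Proof. revert x m. refine (paths_rect_r _ _ _). exact (cells_snd e (inl (inl (tt, y), z))). Qed.

Lemma assoc_path1 (x : X) {y : Y} (m : y = pt) (z : Z) :
  ap f (ap (fun w => sa_pair s2 w z) (ap (fun y => sa_pair s x y) m @ sa_pushl s x)
    @ sa_pushr s2 z) @ point_eq f
  = cells_fst e (x, y, z)
    @ (ap (fun w => sa_pair s2' x w) (ap (fun y => sa_pair s' y z) m @ sa_pushr s' z)
       @ sa_pushl s2' x).
Proof. revert y m. refine (paths_rect_r _ _ _). exact (cells_snd e (inl (inr x, z))). Qed.

Lemma assoc_path2 (x : X) (y : Y) {z : Z} (m : z = pt) :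
  ap f (ap (fun z => sa_pair s2 (sa_pair s x y) z) m @ sa_pushl s2 (sa_pair s x y)) @ point_eq f
  = cells_fst e (x, y, z)
    @ (ap (fun w => sa_pair s2' x w) (ap (fun z => sa_pair s' y z) m @ sa_pushl s' y)
       @ sa_pushl s2' x).
Proof. revert z m. refine (paths_rect_r _ _ _). exact (cells_snd e (inr (x, y))). Qed.
End AssocPaths.

(** * The five edges of the pentagon *)

Section Pentagon.
Context (fe : Funext) (S : forall A B : pType, Smash A B)
  (T : forall A B C : pType, Smash3 A B C) (A B C D : pType).

(* ((AB)C)D, (A(BC))D, A((BC)D), A(B(CD)) and (AB)(CD), in this order. *)
Definition vertex1 :=
  smash_cells (S (wedge S (wedge S A B) C) D) (left_cells (S A B) (S (wedge S A B) C)).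
Definition vertex2 :=
  smash_cells (S (wedge S A (wedge S B C)) D) (right_cells (S B C) (S A (wedge S B C))).
Definition vertex3 :=
  reassociate_cells (smash_cells_right (S A (wedge S (wedge S B C) D))
    (left_cells (S B C) (S (wedge S B C) D))).
Definition vertex4 :=
  reassociate_cells (smash_cells_right (S A (wedge S B (wedge S C D)))
    (right_cells (S C D) (S B (wedge S C D)))).
Definition vertex5 := middle_cells (S A B) (S C D) (S (wedge S A B) (wedge S C D)).

Lemma edge1 : push (wedge_map S (assoc fe S T A B C) (pid D)) vertex1 = vertex2.
Proof.
  exact (push_functor_left fe _ _ _ _ @ ap (smash_cells _) (push_assoc fe S T A B C)).
Qed.

Lemma edge2 : push (assoc fe S T A (wedge S B C) D) vertex2 = vertex3.
Proof.
  pose (f := assoc fe S T A (wedge S B C) D).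
  pose (e := push_assoc fe S T A (wedge S B C) D).
  refine (cells_ext fe (u := push f vertex2) (v := vertex3)
    (fun y => cells_fst e (fst (fst (fst y)),
      sa_pair (smash_str (S B C)) (snd (fst (fst y))) (snd (fst y)), snd y)) _).
  (* The composite factor is the middle one, so both of its hyperplanes use [assoc_path1], along the
     two inner pushes; in [edge4] it is the first factor, in [edge5] the last. *)
  intros [[[[[[r b] | a] c] | [a b]] d] | [[a b] c]].
  - exact (assoc_path0 f e idpath _ d).
  - exact (assoc_path1 f e a (sa_pushr _ c) d).
  - exact (assoc_path1 f e a (sa_pushl _ b) d).
  - exact (assoc_path2 f e a _ idpath).
Qed.

Lemma edge3 : push (wedge_map S (pid A) (assoc fe S T B C D)) vertex3 = vertex4.
Proof.
  refine (push_reassociate_cells fe _ _ @ ap reassociate_cells _).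
  exact (push_functor_right fe _ _ _ _ @ ap (smash_cells_right _) (push_assoc fe S T B C D)).
Qed.

Lemma edge4 : push (assoc fe S T (wedge S A B) C D) vertex1 = vertex5.
Proof.
  pose (f := assoc fe S T (wedge S A B) C D).
  pose (e := push_assoc fe S T (wedge S A B) C D).
  refine (cells_ext fe (u := push f vertex1) (v := vertex5)
    (fun y => cells_fst e (sa_pair (smash_str (S A B)) (fst (fst (fst y))) (snd (fst (fst y))),
      snd (fst y), snd y)) _).
  intros [[[[[[r b] | a] c] | [a b]] d] | [[a b] c]].
  - exact (assoc_path0 f e (sa_pushr _ b) c d).
  - exact (assoc_path0 f e (sa_pushl _ a) c d).
  - exact (assoc_path1 f e _ idpath d).
  - exact (assoc_path2 f e _ c idpath).
Qed.

Lemma edge5 : push (assoc fe S T A B (wedge S C D)) vertex5 = vertex4.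
Proof.
  pose (f := assoc fe S T A B (wedge S C D)).
  pose (e := push_assoc fe S T A B (wedge S C D)).
  refine (cells_ext fe (u := push f vertex5) (v := vertex4)
    (fun y => cells_fst e (fst (fst (fst y)), snd (fst (fst y)),
      sa_pair (smash_str (S C D)) (snd (fst y)) (snd y))) _).
  intros [[[[[[r b] | a] c] | [a b]] d] | [[a b] c]].
  - exact (assoc_path0 f e idpath b _).
  - exact (assoc_path1 f e a idpath _).
  - exact (assoc_path2 f e a b (sa_pushr _ d)).
  - exact (assoc_path2 f e a b (sa_pushl _ c)).
Qed.
End Pentagon.

Theorem proposition20 (fe : Funext)
  (S : forall A B : pType, Smash A B) (T : forall A B C : pType, Smash3 A B C)
  (A B C D : pType) :
  pcompose (wedge_map S (pid A) (assoc fe S T B C D))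
    (pcompose (assoc fe S T A (wedge S B C) D)
      (wedge_map S (assoc fe S T A B C) (pid D)))
  = pcompose (assoc fe S T A B (wedge S C D)) (assoc fe S T (wedge S A B) C D)
  :> pMap (wedge S (wedge S (wedge S A B) C) D) (wedge S A (wedge S B (wedge S C D))).
Proof.
  pose (X := wedge S A (wedge S B (wedge S C D))).
  (* One detection step for each of [B], [C] and [D], starting from the cells of [A]. *)
  assert (d : detects (vertex1 S A B C D) X)
    by exact (smash_detects fe _ _ (smash_detects fe _ _
      (smash_detects fe _ _ (point_detects A X)))).
  destruct d as [N retr].
  (* [N] recovers both composites from their restrictions, so it remains to follow [vertex1] to
     [vertex4] along the two sides. *)
  refine (!(retr _) @ (ap N _ @ retr _)).
  refine (push_pcompose fe _ _ _ @ (ap (push _) (push_pcompose fe _ _ _) @ _)).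
  refine (ap (fun u => push _ (push _ u)) (edge1 fe S T A B C D) @ _).
  refine (ap (push _) (edge2 fe S T A B C D) @ (edge3 fe S T A B C D @ !_)).
  exact (push_pcompose fe _ _ _ @ (ap (push _) (edge4 fe S T A B C D) @ edge5 fe S T A B C D)).
Qed.
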